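(* Let $(X_0,d)$ be an infinite uniformly discrete metric space with bounded geometry, satisfying Yu's Property A. Let $H$ be a band dominated operator in $\ell^2(X_0)$, with matrix $(H(a,a'))_{a,a'\in X_0}$, let $Y_0$ be a subset of $X_0$ with finite complement, and let $H_{Y_0}$ be the operator in $\ell^2(Y_0)$ given by $$[H_{Y_0}(v)](b)=\sum_{b'\in Y_0}H(b,b')v(b')\,,\quad b\in Y_0\,.$$ Let $\Sigma$ be a $C^*$-algebraic spectral set. Then $\Sigma_{\rm ess}(H)=\Sigma_{\rm ess}(H_{Y_0})$.
   Context: A $C^*$-algebraic spectral set $\Sigma$ assigns to every unital $C^*$-algebra $\mathscr E$ and every $E\in\mathscr E$ a closed subset $\Sigma(E\mid\mathscr E)\subset\mathbb C$ such that for every unital $*$-morphism $\pi:\mathscr E\to\mathscr F$ one has $\Sigma(\pi(E)\mid\mathscr F)\subset\Sigma(E\mid\mathscr E)$ for all $E\in\mathscr E$, with equality if $\pi$ is injective. For $H\in\mathbb B(\mathcal H)$, $\Sigma_{\rm ess}(H):=\Sigma\big(\gamma(H)\mid\mathbb B(\mathcal H)/\mathbb K(\mathcal H)\big)$, with $\gamma$ the quotient map to the Calkin algebra. Uniformly discrete: for some $\delta>0$, $d(x,x')\ge\delta$ whenever $x\neq x'$. Bounded geometry: for every $r>0$ there is $N_r<\infty$ such that all balls of radius $r$ have fewer than $N_r$ elements. Property A (for such spaces): for all $R,\epsilon>0$ there are $S>0$ and a map $x\mapsto\xi_x$ from $X_0$ to the unit sphere of $\ell^1(X_0)$ with $\xi_x\ge0$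 supported in the ball of radius $S$ around $x$ and $\|\xi_x-\xi_y\|_1<\epsilon$ whenever $d(x,y)\le R$. Operators $H\in\mathbb B[\ell^2(X_0)]$ are identified with matrices via $[H(u)](a)=\sum_{a'\in X_0}H(a,a')u(a')$. $H$ is a band operator if for some $r>0$ one has $H(a,a')=0$ whenever $d(a,a')>r$, and $\sup_{a,a'}|H(a,a')|<\infty$. $H$ is band dominated if it is an operator-norm limit of band operators. *)

(* Defs.v *)
(* Mathematical Components world (MathComp-Analysis), over an arbitrary
   [R : realType]; the complex numbers are [R[i]].

   Contents: C*-algebras and C*-algebraic spectral sets; the Hilbert space
   [ell2 R X]; the C*-algebra [bop R X] of its bounded operators; the Calkin
   algebra [calkin R X]; coarse-geometric conditions on a metric space; band
   dominated operators and compressions to a subset.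

   Norms are [R[i]]-valued in [normedModType R[i]]; each space below also has
   a real-valued version ([l2norm], [opnorm], [calkin_norm]) of which the norm
   is the image in [R[i]]. *)
From HB Require Import structures.
From mathcomp Require Import all_boot all_order all_algebra.
From mathcomp Require Import generic_quotient ring_quotient.
From mathcomp Require Import finmap all_classical all_reals.
From mathcomp Require Import ereal topology normedtype sequences esum.
From mathcomp Require summability.
From mathcomp Require Import complex ring lra.

Set Implicit Arguments.
Unset Strict Implicit.
Unset Printing Implicit Defensive.

Import Order.TTheory GRing.Theory Num.Theory.
Import numFieldNormedType.Exports.
Import ComplexField.Normc.

Local Open Scope classical_set_scope.
Local Open Scope ring_scope.

(* Unital complex C*-algebras: [cmul] is the product, [cone] the unit, [adj] the
   involution. The ring structure is not inherited from [GRing.PzRing] because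
   Hierarchy-Builder does not allow the join of rings and normed modules below
   [Num.NumDomain]. The zero algebra (cone = 0) is not excluded. *)
HB.mixin Record CompleteNormedModule_isCstarAlgebra (K : numClosedFieldType) A
    of CompleteNormedModule K A := {
  cmul : A -> A -> A ;
  cone : A ;
  adj : A -> A ;
  cmulA : associative cmul ;
  cmul1x : left_id cone cmul ;
  cmulx1 : right_id cone cmul ;
  cmulDl : left_distributive cmul +%R ;
  cmulDr : right_distributive cmul +%R ;
  cmulZl : forall (k : K) (x y : A), cmul (k *: x) y = k *: cmul x y ;
  cmulZr : forall (k : K) (x y : A), cmul x (k *: y) = k *: cmul x y ;
  cnormM : forall x y : A, `|cmul x y| <= `|x| * `|y| ;
  adjD : forall x y : A, adj (x + y) = adj x + adj y ;
  adjZ : forall (k : K) (x : A), adj (k *: x) = Num.conj k *: adj x ;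
  adjM : forall x y : A, adj (cmul x y) = cmul (adj y) (adj x) ;
  adjK : involutive adj ;
  cstar_identity : forall x : A, `|cmul (adj x) x| = `|x| ^+ 2
}.

#[short(type="cstarAlgType")]
HB.structure Definition CstarAlgebra (K : numClosedFieldType) :=
  {A of CompleteNormedModule K A & CompleteNormedModule_isCstarAlgebra K A}.

Definition unital_star_morphism (K : numClosedFieldType) (E F : cstarAlgType K)
    (pi : E -> F) : Prop :=
  [/\ linear pi, {morph pi : x y / cmul x y}, pi cone = cone
    & {morph pi : x / adj x}].

Record cstar_spectral_set (R : realType) := CstarSpectralSet {
  spec :> forall E : cstarAlgType R[i], E -> set R[i] ;
  spec_closed : forall (E : cstarAlgType R[i]) (x : E),
    closed (spec x : set R[i]^o) ;
  spec_morph : forall (E F : cstarAlgType R[i]) (pi : E -> F),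
    unital_star_morphism pi -> forall x, spec (pi x) `<=` spec x ;
  spec_inj : forall (E F : cstarAlgType R[i]) (pi : E -> F),
    unital_star_morphism pi -> injective pi ->
    forall x, spec (pi x) = spec x
}.

Section normc_theory.
Variable R : realType.
Implicit Types x y z : R[i].

Lemma normcE z : `|z| = (normc z)%:C%C. Proof. by []. Qed.

Lemma normc_ge0 z : 0 <= normc z.
Proof. by case: z => a b /=; exact: sqrtr_ge0. Qed.

Lemma ler_normcD x y : normc (x + y) <= normc x + normc y.
Proof. by have := ler_normD x y; rewrite !normcE -rmorphD lecR. Qed.

Lemma normcN z : normc (- z) = normc z.
Proof. by have [] : `|- z| = `|z| by rewrite normrN. Qed.

Lemma normc_real (a : R) : normc a%:C%C = `|a|.
Proof. by rewrite /= expr0n addr0 sqrtr_sqr. Qed.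

Lemma normc_conj z : normc (Num.conj z) = normc z.
Proof. by have [] : `|Num.conj z| = `|z| by rewrite norm_conjC. Qed.

Lemma normc_sum I (s : seq I) (F : I -> R[i]) :
  normc (\sum_(i <- s) F i) <= \sum_(i <- s) normc (F i).
Proof.
elim: s => [|i s IH]; first by rewrite !big_nil normc0.
by rewrite !big_cons (le_trans (ler_normcD _ _))// lerD2l.
Qed.
End normc_theory.

Section psum.
Variables (R : realType) (X : choiceType).
Implicit Types (u v w : X -> R[i]) (F G : {fset X}).

Definition psum u F : R := \sum_(x <- F) normc (u x) ^+ 2.

Lemma psum_ge0 u F : 0 <= psum u F.
Proof. by apply: sumr_ge0 => x _; rewrite sqr_ge0. Qed.

Lemma eq_psum u v F : (forall x, x \in F -> u x = v x) -> psum u F = psum v F.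
Proof. by move=> e; rewrite /psum; apply: eq_big_seq => x xF; rewrite e. Qed.

Lemma psumS u F G : (F `<=` G)%fset -> psum u F <= psum u G.
Proof.
move=> FG; rewrite /psum.
rewrite [leRHS](big_fsetID _ (fun x => x \in F))/=.
have -> : [fset x in G | x \in F]%fset = F.
  apply/fsetP => x; rewrite !inE/=; apply/andP/idP => [[]//|xF].
  by split => //; exact: (fsubsetP FG).
by rewrite lerDl sumr_ge0// => x _; rewrite sqr_ge0.
Qed.

Lemma psum_esum u (c : R) :
  (\esum_(x in [set: X]) ((normc (u x)) ^+ 2)%:E <= c%:E)%E <->
  (forall F, psum u F <= c).
Proof.
split=> [h F|h].
  rewrite -lee_fin; apply: le_trans h; rewrite /psum -sumEFin.
  apply: esum_ge; exists [set` F]; first by split.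
  by rewrite fsbig_finite//= set_fsetK.
apply: ge_ereal_sup => _ [A [fA _]] <-.
rewrite fsbig_finite//= sumEFin lee_fin; exact: h.
Qed.

Definition pnorm u F : R := Num.sqrt (psum u F).

Lemma pnorm_ge0 u F : 0 <= pnorm u F. Proof. exact: sqrtr_ge0. Qed.

Lemma pnorm_sqr u F : pnorm u F ^+ 2 = psum u F.
Proof. by rewrite sqr_sqrtr// psum_ge0. Qed.

Lemma pnorm_leP u F (c : R) : 0 <= c -> (pnorm u F <= c) = (psum u F <= c ^+ 2).
Proof.
by move=> c0; rewrite -pnorm_sqr ler_pXn2r// ?nnegrE// pnorm_ge0.
Qed.

Lemma eq_pnorm u v F : (forall x, x \in F -> u x = v x) -> pnorm u F = pnorm v F.
Proof. by move=> e; rewrite /pnorm (eq_psum e). Qed.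

Lemma pnormS u F G : (F `<=` G)%fset -> pnorm u F <= pnorm u G.
Proof. by move=> FG; rewrite ler_wsqrtr// psumS. Qed.

Lemma pnormZ (k : R[i]) u F : pnorm (fun x => k * u x) F = normc k * pnorm u F.
Proof.
rewrite /pnorm /psum; under eq_bigr do rewrite normcM exprMn.
by rewrite -mulr_sumr sqrtrM ?sqr_ge0// sqrtr_sqr ger0_norm ?normc_ge0.
Qed.

Lemma pnormN u F : pnorm (fun x => - u x) F = pnorm u F.
Proof. by rewrite /pnorm /psum; under eq_bigr do rewrite normcN. Qed.

Lemma psumD_pos u v F (a b : R) : 0 < a -> 0 < b ->
  psum u F <= a ^+ 2 -> psum v F <= b ^+ 2 ->
  psum (fun x => u x + v x) F <= (a + b) ^+ 2.
Proof.
move=> a0 b0 ua vb.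
have key x : normc (u x + v x) ^+ 2 <=
    (1 + b / a) * normc (u x) ^+ 2 + (1 + a / b) * normc (v x) ^+ 2.
  have h := ler_normcD (u x) (v x).
  apply: (@le_trans _ _ ((normc (u x) + normc (v x)) ^+ 2)).
    by rewrite ler_pXn2r// ?nnegrE ?addr_ge0 ?normc_ge0.
  set p := normc (u x); set q := normc (v x); rewrite -subr_ge0.
  suff -> : (1 + b / a) * p ^+ 2 + (1 + a / b) * q ^+ 2 - (p + q) ^+ 2 =
    (b * p - a * q) ^+ 2 / (a * b) by rewrite divr_ge0 ?sqr_ge0 ?mulr_ge0 ?ltW.
  field; by rewrite (gt_eqF a0) (gt_eqF b0).
rewrite /psum; apply: le_trans (ler_sum _ (fun x _ => key x)) _.
rewrite big_split/= -!mulr_sumr.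
have -> : (a + b) ^+ 2 = (1 + b / a) * a ^+ 2 + (1 + a / b) * b ^+ 2.
  by field; rewrite (gt_eqF a0) (gt_eqF b0).
by rewrite lerD// ler_wpM2l// addr_ge0// divr_ge0// ltW.
Qed.

Lemma pnormD u v F :
  pnorm (fun x => u x + v x) F <= pnorm u F + pnorm v F.
Proof.
apply/ler_addgt0Pr => e e0.
have e20 : 0 < e / 2 by rewrite divr_gt0.
have pu := pnorm_ge0 u F; have pv := pnorm_ge0 v F.
rewrite pnorm_leP; last by rewrite !addr_ge0// ltW.
have -> : pnorm u F + pnorm v F + e = (pnorm u F + e / 2) + (pnorm v F + e / 2).
  by rewrite addrACA -splitr.
apply: psumD_pos; rewrite ?ltr_wpDl// -pnorm_leP ?lerDl ?addr_ge0// ltW//.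
Qed.

Lemma normc_pnorm u F x : x \in F -> normc (u x) <= pnorm u F.
Proof.
move=> xF; rewrite -[leLHS]ger0_norm ?normc_ge0// -sqrtr_sqr ler_wsqrtr//.
by rewrite /psum (big_fsetD1 x)//= lerDl sumr_ge0// => y _; rewrite sqr_ge0.
Qed.

Lemma pnorm_sum u F : pnorm u F <= \sum_(x <- F) normc (u x).
Proof.
rewrite pnorm_leP ?sumr_ge0// => [|x _]; last exact: normc_ge0.
rewrite /psum; elim: (enum_fset F) => [|x s IH]; first by rewrite !big_nil expr0n.
rewrite !big_cons sqrrD -addrA lerD2l (le_trans IH)// lerDr mulrn_wge0//.
by rewrite mulr_ge0 ?normc_ge0// sumr_ge0// => y _; exact: normc_ge0.
Qed.

Lemma pnorm_CS u v F :
  \sum_(x <- F) normc (u x) * normc (v x) <= pnorm u F * pnorm v F.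
Proof.
have pos (a b : R) : 0 < a -> 0 < b -> pnorm u F <= a -> pnorm v F <= b ->
    \sum_(x <- F) normc (u x) * normc (v x) <= a * b.
  move=> a0 b0; rewrite (pnorm_leP _ _ (ltW a0)) (pnorm_leP _ _ (ltW b0)) => ua vb.
  have key x : normc (u x) * normc (v x) <=
    b / a / 2 * normc (u x) ^+ 2 + a / b / 2 * normc (v x) ^+ 2.
    set p := normc (u x); set q := normc (v x); rewrite -subr_ge0.
    suff -> : b / a / 2 * p ^+ 2 + a / b / 2 * q ^+ 2 - p * q =
      (b * p - a * q) ^+ 2 / (2 * a * b).
      by rewrite divr_ge0 ?sqr_ge0 ?mulr_ge0 ?ltW.
    field; by rewrite (gt_eqF a0) (gt_eqF b0).
  apply: le_trans (ler_sum _ (fun x _ => key x)) _.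
  rewrite big_split/= -!mulr_sumr.
  have -> : a * b = b / a / 2 * a ^+ 2 + a / b / 2 * b ^+ 2.
    by field; rewrite (gt_eqF a0) (gt_eqF b0).
  by rewrite lerD// ler_wpM2l// !divr_ge0// ltW.
have [pu pv] := (pnorm_ge0 u F, pnorm_ge0 v F).
apply/ler_addgt0Pr => e e0.
set p := pnorm u F in pu pos *; set q := pnorm v F in pv pos *.
pose d := Num.min 1 (e / (p + q + 1)).
have pq0 : 0 < p + q + 1 by rewrite ltr_wpDl// addr_ge0.
have d0 : 0 < d by rewrite lt_min ltr01/= divr_gt0.
have d1 : d <= 1 by rewrite ge_min lexx.
have de : d * (p + q + 1) <= e by rewrite -ler_pdivlMr// ge_min lexx orbT.
apply: (@le_trans _ _ ((p + d) * (q + d))).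
  by apply: pos; rewrite ?ltr_wpDl// lerDl ltW.
have -> : (p + d) * (q + d) = p * q + d * (p + q + d) by ring.
by rewrite lerD2l (le_trans _ de)// ler_wpM2l ?(ltW d0)// lerD2l.
Qed.

End psum.

Section complete_criterion.
Variable R : realType.

Lemma posc (e : R[i]) : 0 < e -> exists2 r : R, 0 < r & e = r%:C%C.
Proof.
case: e => a b; rewrite ltcE/= => /andP[/eqP b0 a0].
by exists a => //; rewrite b0.
Qed.

Lemma complete_criterion (V : normedModType R[i]) (nr : V -> R) :
  (forall v, `|v| = (nr v)%:C%C) ->
  (forall u : nat -> V,
    (forall n m, (n <= m)%N -> nr (u n - u m) <= 2^-1 ^+ n) ->
    exists l, forall e : R, 0 < e ->
      exists N, forall n, (N <= n)%N -> nr (u n - l) <= e) ->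
  forall F : set_system V, ProperFilter F -> cauchy F -> cvg F.
Proof.
move=> nrE seqcvg F FF /cauchyP Fc.
have i2 n : 0 < (2^-1 ^+ n : R) by rewrite exprn_gt0// invr_gt0.
have ex n : exists x, F (ball x (2^-1 ^+ n.+1 : R)%:C%C).
  by apply: Fc; rewrite ltcR i2.
pose u n := projT1 (cid (ex n)).
have uF n : F (ball (u n) (2^-1 ^+ n.+1 : R)%:C%C) by exact: projT2 (cid (ex n)).
have half n : (2^-1 ^+ n.+1 : R) + 2^-1 ^+ n.+1 = 2^-1 ^+ n.
  by rewrite exprS; field.
have [n m nm|l lP] := seqcvg u.
  have /filter_ex[y [/= yn ym]] : F (ball (u n) (2^-1 ^+ n.+1 : R)%:C%C `&`
     ball (u m) (2^-1 ^+ m.+1 : R)%:C%C) by exact: filterI.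
  move: yn ym; rewrite -ball_normE/= => yn ym.
  rewrite -lecR -nrE -half rmorphD.
  rewrite (le_trans (ler_distD y _ _))// lerD//; first exact: ltW.
  rewrite distrC (le_trans (ltW ym))// lecR ler_wiXn2l ?invr_ge0//.
  by rewrite invf_le1// ler1n.
apply/cvg_ex; exists l; apply/cvgrPdist_le => e /posc[r r0 ->].
have r20 : 0 < r / 2 by rewrite divr_gt0.
have [N NP] := lP _ r20.
have [M MP] : exists M, 2^-1 ^+ M.+1 <= r / 2.
  have : (fun n => 2^-1 ^+ n : R) @ \oo --> (0 : R).
    by apply: cvg_expr; rewrite ger0_norm ?invr_ge0// invf_lt1// ltr1n.
  move/cvgrPdist_le => /(_ _ r20)[M _ MP]; exists M.
  have /= := MP M.+1 (leqnSn M).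
  by rewrite sub0r normrN ger0_norm// ltW.
pose n := maxn N M.
have := uF n; apply: filterS => y; rewrite -ball_normE/= => yn.
rewrite (le_trans (ler_distD (u n) _ _))//.
have -> : r%:C%C = (r / 2)%:C%C + (r / 2)%:C%C by rewrite -rmorphD -splitr.
rewrite lerD//; first by rewrite distrC nrE lecR NP// leq_maxl.
rewrite (le_trans (ltW yn))// lecR (le_trans _ MP)// ler_wiXn2l ?invr_ge0//.
  by rewrite invf_le1// ler1n.
by rewrite ltnS leq_maxr.
Qed.

Lemma R_fast (x : nat -> R) (d : nat -> R) :
  (forall n m, (n <= m)%N -> `|x n - x m| <= d n) ->
  (forall n m, (n <= m)%N -> d m <= d n) ->
  exists l, forall n, `|x n - l| <= d n.
Proof.
move=> xd dd.
have d0 n : 0 <= d n by apply: le_trans (xd n n (leqnn n)).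
pose A := [set x n - d n | n in [set: nat]].
have ubA m : ubound A (x m + d m).
  move=> _ [n _ <-].
  have [nm|/ltnW mn] := leqP n m.
    by have := xd _ _ nm; have := d0 m; rewrite ler_norml => ? /andP[]; lra.
  by have := xd _ _ mn; have := d0 n; rewrite ler_norml => ? /andP[]; lra.
have sA : has_sup A by split; [exists (x 0%N - d 0%N); exists 0%N|exists (x 0%N + d 0%N)].
exists (sup A) => n.
have h1 : x n - d n <= sup A by apply: sup_upper_bound => //; exists n.
have h2 : sup A <= x n + d n by apply: ge_sup => //; exact: sA.1.
by rewrite ler_norml; apply/andP; split; lra.
Qed.

Lemma C_fast (x : nat -> R[i]) (d : nat -> R) :
  (forall n m, (n <= m)%N -> normc (x n - x m) <= d n) ->
  (forall n m, (n <= m)%N -> d m <= d n) ->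
  exists l, forall n, normc (x n - l) <= d n *+ 2.
Proof.
move=> xd dd.
have ReIm (z : R[i]) : `|complex.Re z| <= normc z /\ `|complex.Im z| <= normc z.
  case: z => a b /=; rewrite -!sqrtr_sqr; split; rewrite ler_wsqrtr//.
    by rewrite lerDl sqr_ge0.
  by rewrite lerDr sqr_ge0.
have ReB (z w : R[i]) : complex.Re (z - w) = complex.Re z - complex.Re w by case: z w => ? ? [].
have ImB (z w : R[i]) : complex.Im (z - w) = complex.Im z - complex.Im w by case: z w => ? ? [].
have [n m nm|a aP] := @R_fast (fun n => complex.Re (x n)) d _ dd.
  by rewrite /= -ReB (le_trans (ReIm _).1)// xd.
have [n m nm|b bP] := @R_fast (fun n => complex.Im (x n)) d _ dd.
  by rewrite /= -ImB (le_trans (ReIm _).2)// xd.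
exists (a +i* b)%C => n; have := aP n; have := bP n; case: (x n) => p q /= hb ha.
have d0 : 0 <= d n by exact: le_trans ha.
rewrite -[leRHS]ger0_norm ?mulrn_wge0// -sqrtr_sqr ler_wsqrtr//.
rewrite -[_ - a in X in X <= _]/(p - a).
have sq (t : R) : `|t| <= d n -> t ^+ 2 <= d n ^+ 2.
  by move=> h; rewrite -[t ^+ 2]ger0_norm ?sqr_ge0// normrX ler_pXn2r ?nnegrE.
have ha2 := sq _ ha; have hb2 := sq _ hb.
by rewrite -mulr_natr exprMn; have := sqr_ge0 (d n); lra.
Qed.
End complete_criterion.

(* Square-summable functions X -> C; [\esum] is the supremum of the finite
   partial sums. *)
Record ell2 (R : realType) (X : choiceType) := Ell2 {
  ell2_fun :> X -> R[i] ;
  ell2_sum :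
    (\esum_(x in [set: X]) (normc (ell2_fun x) ^+ 2)%:E < +oo)%E
}.

Section ell2_space.
Variables (R : realType) (X : choiceType).
Local Notation V := (ell2 R X).
Implicit Types (u v w : V) (F G : {fset X}).

HB.instance Definition _ := gen_eqMixin V.
HB.instance Definition _ := gen_choiceMixin V.

Lemma ell2P u v : (forall x, u x = v x) -> u = v.
Proof.
case: u v => [u hu] [v hv]/= /funext e; subst v; congr Ell2; exact: Prop_irrelevance.
Qed.

Definition l2norm u : R :=
  Num.sqrt (fine (\esum_(x in [set: X]) (normc (u x) ^+ 2)%:E)).

Lemma esum_sqr u :
  \esum_(x in [set: X]) (normc (u x) ^+ 2)%:E = (l2norm u ^+ 2)%:E.
Proof.
have h0 : (0 <= \esum_(x in [set: X]) (normc (u x) ^+ 2)%:E)%E.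
  by apply: esum_ge0 => x _; rewrite lee_fin sqr_ge0.
rewrite sqr_sqrtr ?fine_ge0// fineK// ge0_fin_numE//; exact: ell2_sum.
Qed.

Lemma l2norm_ge0 u : 0 <= l2norm u. Proof. exact: sqrtr_ge0. Qed.

Lemma pnorm_le u F : pnorm u F <= l2norm u.
Proof.
rewrite pnorm_leP ?l2norm_ge0//; move: F; apply/psum_esum; by rewrite esum_sqr.
Qed.

Lemma l2norm_le u (c : R) : 0 <= c ->
  (forall F, pnorm u F <= c) -> l2norm u <= c.
Proof.
move=> c0 h; rewrite -(@ler_pXn2r _ 2)// ?nnegrE ?l2norm_ge0// -lee_fin -esum_sqr.
by apply/psum_esum => F; rewrite -pnorm_leP.
Qed.

Lemma normc_le u x : normc (u x) <= l2norm u.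
Proof. by apply: le_trans (pnorm_le u [fset x]%fset); rewrite normc_pnorm// !inE. Qed.

Lemma ell2_subproof (f : X -> R[i]) (c : R) : (forall F, pnorm f F <= c) ->
  (\esum_(x in [set: X]) (normc (f x) ^+ 2)%:E < +oo)%E.
Proof.
move=> h; apply: (@le_lt_trans _ _ (c ^+ 2)%:E); last exact: ltry.
have c0 : 0 <= c by apply: le_trans (h fset0); rewrite pnorm_ge0.
by apply/psum_esum => F; rewrite -pnorm_leP.
Qed.

Definition mkell2 (f : X -> R[i]) (c : R) (h : forall F, pnorm f F <= c) : V :=
  Ell2 (ell2_subproof h).

Lemma pnorm0 F : pnorm (fun=> 0 : R[i]) F = 0.
Proof.
by rewrite /pnorm /psum big1 ?sqrtr0// => x _; rewrite normc0 expr0n.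
Qed.

Fact ell2_add_subproof u v F :
  pnorm (fun x => u x + v x) F <= l2norm u + l2norm v.
Proof. by rewrite (le_trans (pnormD _ _ _))// lerD// pnorm_le. Qed.

Fact ell2_opp_subproof u F : pnorm (fun x => - u x) F <= l2norm u.
Proof. by rewrite pnormN pnorm_le. Qed.

Fact ell2_zero_subproof F : pnorm (fun=> 0 : R[i]) F <= 0.
Proof. by rewrite pnorm0. Qed.

Fact ell2_scale_subproof (k : R[i]) u F :
  pnorm (fun x => k * u x) F <= normc k * l2norm u.
Proof. by rewrite pnormZ ler_wpM2l ?normc_ge0// pnorm_le. Qed.

Definition ell2_zero : V := mkell2 ell2_zero_subproof.
Definition ell2_add u v : V := mkell2 (ell2_add_subproof u v).
Definition ell2_opp u : V := mkell2 (ell2_opp_subproof u).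
Definition ell2_scale k u : V := mkell2 (ell2_scale_subproof k u).

Fact ell2_addA : associative ell2_add.
Proof. by move=> u v w; apply: ell2P => x /=; rewrite addrA. Qed.
Fact ell2_addC : commutative ell2_add.
Proof. by move=> u v; apply: ell2P => x /=; rewrite addrC. Qed.
Fact ell2_add0 : left_id ell2_zero ell2_add.
Proof. by move=> u; apply: ell2P => x /=; rewrite add0r. Qed.
Fact ell2_addN : left_inverse ell2_zero ell2_opp ell2_add.
Proof. by move=> u; apply: ell2P => x /=; rewrite addNr. Qed.

HB.instance Definition _ :=
  GRing.isZmodule.Build V ell2_addA ell2_addC ell2_add0 ell2_addN.

Fact ell2_scaleA a b u : ell2_scale a (ell2_scale b u) = ell2_scale (a * b) u.
Proof. by apply: ell2P => x /=; rewrite mulrA. Qed.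
Fact ell2_scale1 : left_id 1 ell2_scale.
Proof. by move=> u; apply: ell2P => x /=; rewrite mul1r. Qed.
Fact ell2_scaleDr : right_distributive ell2_scale +%R.
Proof. by move=> k u v; apply: ell2P => x /=; rewrite mulrDr. Qed.
Fact ell2_scaleDl u : {morph ell2_scale^~ u : a b / a + b}.
Proof. by move=> a b; apply: ell2P => x /=; rewrite mulrDl. Qed.

HB.instance Definition _ := GRing.Zmodule_isLmodule.Build R[i] V
  ell2_scaleA ell2_scale1 ell2_scaleDr ell2_scaleDl.

Lemma ell2DE u v x : (u + v) x = u x + v x. Proof. by []. Qed.
Lemma ell2NE u x : (- u) x = - u x. Proof. by []. Qed.
Lemma ell2BE u v x : (u - v) x = u x - v x. Proof. by []. Qed.
Lemma ell2ZE (k : R[i]) u x : (k *: u) x = k * u x. Proof. by []. Qed.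
Lemma ell20E x : (0 : V) x = 0. Proof. by []. Qed.
Lemma ell2_sumE I (s : seq I) (f : I -> V) x :
  (\sum_(i <- s) f i) x = \sum_(i <- s) f i x.
Proof. by elim: s => [|i s IH]; rewrite ?big_nil// !big_cons ell2DE IH. Qed.

Lemma l2normD u v : l2norm (u + v) <= l2norm u + l2norm v.
Proof.
apply: l2norm_le; first by rewrite addr_ge0 ?l2norm_ge0.
exact: ell2_add_subproof.
Qed.

Lemma l2norm0_eq0 u : l2norm u = 0 -> u = 0.
Proof.
move=> u0; apply: ell2P => x; apply: eq0_normc; apply/eqP.
by rewrite eq_le normc_ge0 andbT -u0 normc_le.
Qed.

Lemma l2normZ_le (k : R[i]) u : l2norm (k *: u) <= normc k * l2norm u.
Proof.
apply: l2norm_le; first by rewrite mulr_ge0 ?l2norm_ge0 ?normc_ge0.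
exact: ell2_scale_subproof.
Qed.

Lemma l2normZ (k : R[i]) u : l2norm (k *: u) = normc k * l2norm u.
Proof.
apply/eqP; rewrite eq_le l2normZ_le/=.
have [->|k0] := eqVneq k 0; first by rewrite normc0 mul0r l2norm_ge0.
have nk : 0 < normc k.
  rewrite lt_neqAle normc_ge0 andbT eq_sym.
  by apply: contra k0 => /eqP/eq0_normc ->.
rewrite -ler_pdivlMl// -normcV.
by have := l2normZ_le k^-1 (k *: u); rewrite scalerA mulVf// scale1r.
Qed.

Fact ell2_normD u v : (l2norm (u + v))%:C%C <= (l2norm u)%:C%C + (l2norm v)%:C%C :> R[i].
Proof. by rewrite -rmorphD lecR l2normD. Qed.
Fact ell2_normZ (k : R[i]) u : (l2norm (k *: u))%:C%C = `|k| * (l2norm u)%:C%C :> R[i].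
Proof. by rewrite l2normZ rmorphM. Qed.
Fact ell2_norm0 u : (l2norm u)%:C%C = 0 :> R[i] -> u = 0.
Proof. by move=> [] /l2norm0_eq0. Qed.

HB.instance Definition _ := Lmodule_isNormed.Build R[i] V
  ell2_normD ell2_normZ ell2_norm0.

Lemma ell2_normE u : `|u| = (l2norm u)%:C%C. Proof. by []. Qed.

Lemma l2norm0 : l2norm 0 = 0.
Proof. by have [] : `|0 : V| = 0 by rewrite normr0. Qed.
Lemma l2normN u : l2norm (- u) = l2norm u.
Proof. by have [] : `|- u| = `|u| by rewrite normrN. Qed.
Lemma l2normB u v : l2norm (u - v) <= l2norm u + l2norm v.
Proof. by rewrite -(l2normN v) l2normD. Qed.
Lemma l2norm_distC u v : l2norm (u - v) = l2norm (v - u).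
Proof. by rewrite -l2normN opprB. Qed.

Lemma pnorm_small (f : nat -> X -> R[i]) F :
  (forall x (e : R), 0 < e -> exists N, forall n, (N <= n)%N -> normc (f n x) <= e) ->
  forall e : R, 0 < e -> exists N, forall n, (N <= n)%N -> pnorm (f n) F <= e.
Proof.
move=> fx.
suff h (s : seq X) (e : R) : 0 < e -> exists N, forall n, (N <= n)%N ->
    \sum_(x <- s) normc (f n x) <= e.
  move=> e /(h (enum_fset F))[N NP]; exists N => n /NP.
  by apply: le_trans; exact: pnorm_sum.
elim: s e => [|x s IH] e e0; first by exists 0%N => n _; rewrite big_nil ltW.
have e20 : 0 < e / 2 by rewrite divr_gt0.
have [N NP] := fx x _ e20; have [M MP] := IH _ e20.
exists (maxn N M) => n; rewrite geq_max => /andP[/NP h1 /MP h2].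
by rewrite big_cons (splitr e) lerD.
Qed.

Lemma ell2_seq_cvg (u : nat -> V) (d : nat -> R) :
  (forall n m, (n <= m)%N -> l2norm (u n - u m) <= d n) ->
  (forall n m, (n <= m)%N -> d m <= d n) ->
  (forall e, 0 < e -> exists N, d N <= e) ->
  exists l, forall n, l2norm (u n - l) <= d n.
Proof.
move=> ud dd dsmall.
have ex x : exists l, forall n, normc (u n x - l) <= d n *+ 2.
  by apply: C_fast => // n m nm; rewrite -ell2BE (le_trans (normc_le _ _))// ud.
pose l x := projT1 (cid (ex x)).
have lP x n : normc (u n x - l x) <= d n *+ 2 by exact: projT2 (cid (ex x)) n.
have d0 n : 0 <= d n by apply: le_trans (ud n n (leqnn n)); exact: l2norm_ge0.
have key n F : pnorm (fun x => u n x - l x) F <= d n.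
  apply/ler_addgt0Pr => e e0.
  have [N NP] : exists N, forall m, (N <= m)%N ->
      pnorm (fun x => u m x - l x) F <= e.
    apply: (@pnorm_small (fun m x => u m x - l x)) => // x e' e'0.
    have [N NP] : exists N, d N <= e' / 2 by apply: dsmall; rewrite divr_gt0.
    exists N => m Nm; apply: le_trans (lP x m) _.
    by rewrite (splitr e') -mulr2n lerMn2r/= (le_trans (dd _ _ Nm)).
  pose m := maxn n N.
  rewrite (@eq_pnorm _ _ _ (fun x => (u n - u m) x + (u m x - l x))); last first.
    by move=> x _; rewrite ell2BE addrA subrK.
  apply: le_trans (pnormD _ _ _) _; rewrite lerD ?NP ?leq_maxr//.
  by apply: le_trans (pnorm_le _ _) _; rewrite ud// leq_maxl.
have lF F : pnorm l F <= l2norm (u 0%N) + d 0%N.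
  rewrite (@eq_pnorm _ _ _ (fun x => u 0%N x + - (u 0%N x - l x))); last first.
    by move=> x _; rewrite opprB addrC subrK.
  by apply: le_trans (pnormD _ _ _) _; rewrite pnormN lerD ?pnorm_le.
exists (mkell2 lF) => n; apply: l2norm_le => // F; exact: key.
Qed.

Lemma half_small (e : R) : 0 < e -> exists N, (2^-1 ^+ N : R) <= e.
Proof.
move=> e0; have : (fun n => 2^-1 ^+ n : R) @ \oo --> (0 : R).
  by apply: cvg_expr; rewrite ger0_norm ?invr_ge0// invf_lt1// ltr1n.
move/cvgrPdist_le => /(_ _ e0)[M _ MP]; exists M.
by have /= := MP M (leqnn M); rewrite sub0r normrN ger0_norm// ltW.
Qed.

Lemma half_mono (n m : nat) : (n <= m)%N -> (2^-1 ^+ m : R) <= 2^-1 ^+ n.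
Proof.
by move=> nm; rewrite ler_wiXn2l ?invr_ge0// invf_le1// ler1n.
Qed.

Lemma ell2_complete (F : set_system V) : ProperFilter F -> cauchy F -> cvg F.
Proof.
apply: (complete_criterion ell2_normE) => u ud.
have [l lP] := ell2_seq_cvg ud half_mono half_small.
exists l => e /half_small[N NP]; exists N => n Nn.
by rewrite (le_trans (lP n))// (le_trans (half_mono Nn)).
Qed.

HB.instance Definition _ := Uniform_isComplete.Build V ell2_complete.

End ell2_space.

Section is_sum.
Variables (R : realType) (X : choiceType).
Implicit Types (f g : X -> R[i]) (l m : R[i]).

(* Unconditional convergence of a series indexed by X. *)
Definition is_sum f l := forall e : R, 0 < e ->
  exists A : {fset X}, forall B : {fset X}, (A `<=` B)%fset ->
    normc (l - \sum_(x <- B) f x) <= e.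

Lemma is_sumP f l : is_sum f l <->
  (summability.partial_sum (f : X -> R[i]^o) @ summability.totally --> (l : R[i]^o)).
Proof.
have psE B : summability.partial_sum (f : X -> R[i]^o) B = \sum_(x <- B) f x.
  by rewrite /summability.partial_sum big_seq_fsetE.
have TF := @summability.totally_filter X.
split=> [h|/cvgrPdist_le h e e0].
  apply/cvgrPdist_le => e /posc[r /h[A AP] ->].
  by exists A => // B /= AB; rewrite psE normcE lecR AP.
have [|A _ AP] := h e%:C%C; first by rewrite ltcR.
by exists A => B /(AP B)/=; rewrite psE normcE lecR.
Qed.

Lemma sumE f l : is_sum f l -> summability.sum (f : X -> R[i]^o) = l.
Proof.
have TF := @summability.totally_filter X.
move/is_sumP => h; apply: cvg_lim => //; exact: norm_hausdorff.
Qed.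

Lemma is_sum_uniq f l m : is_sum f l -> is_sum f m -> l = m.
Proof. by move=> /sumE <- /sumE <-. Qed.

Lemma is_sumD f g l m : is_sum f l -> is_sum g m ->
  is_sum (fun x => f x + g x) (l + m).
Proof.
move=> fl gm e e0; have e20 : 0 < e / 2 by rewrite divr_gt0.
have [A AP] := fl _ e20; have [B BP] := gm _ e20.
exists (A `|` B)%fset => D; rewrite fsubUset => /andP[/AP h1 /BP h2].
rewrite big_split/= opprD addrACA (splitr e).
by rewrite (le_trans (ler_normcD _ _))// lerD.
Qed.

Lemma is_sumZ (k : R[i]) f l : is_sum f l -> is_sum (fun x => k * f x) (k * l).
Proof.
move=> fl e e0.
have k0 : 0 < normc k + 1 by rewrite ltr_wpDl ?normc_ge0.
have [A AP] := fl _ (divr_gt0 e0 k0).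
exists A => B /AP h; rewrite -mulr_sumr -mulrBr normcM.
apply: (@le_trans _ _ ((normc k + 1) * normc (l - \sum_(x <- B) f x))).
  by rewrite ler_wpM2r ?normc_ge0// lerDl.
by rewrite -ler_pdivlMl// mulrC.
Qed.

Lemma eq_is_sum f g l : f =1 g -> is_sum f l -> is_sum g l.
Proof. by move=> /funext ->. Qed.

Lemma is_sum_conj f l : is_sum f l ->
  is_sum (fun x => Num.conj (f x)) (Num.conj l).
Proof.
move=> fl e /fl[A AP]; exists A => B /AP.
by rewrite -rmorph_sum -rmorphB normc_conj.
Qed.

Lemma is_sum_le f l (c : R) : (forall F : {fset X}, normc (\sum_(x <- F) f x) <= c) ->
  is_sum f l -> normc l <= c.
Proof.
move=> fc fl; apply/ler_addgt0Pr => e /fl[A /(_ A (fsubset_refl _)) h].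
rewrite -[l](subrK (\sum_(x <- A) f x)) addrC.
by rewrite (le_trans (ler_normcD _ _))// lerD.
Qed.

Lemma is_sum_sqr (u : ell2 R X) :
  is_sum (fun x => ((normc (u x)) ^+ 2)%:C%C) (l2norm u ^+ 2)%:C%C.
Proof.
move=> e e0.
have [A AP] : exists A, l2norm u ^+ 2 - e < psum u A.
  apply: contrapT => /forallNP h.
  have /psum_esum : forall F, psum u F <= l2norm u ^+ 2 - e.
    by move=> F; rewrite leNgt; apply/negP/h.
  by rewrite esum_sqr lee_fin; lra.
exists A => B AB; rewrite -rmorph_sum -rmorphB normc_real -[\sum_(_ <- _) _]/(psum u B).
have h1 := psumS u AB.
have h2 : psum u B <= l2norm u ^+ 2 by rewrite -pnorm_leP ?l2norm_ge0// pnorm_le.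
by rewrite ler_norml; apply/andP; split; lra.
Qed.
End is_sum.

Section inner.
Variables (R : realType) (X : choiceType).
Local Notation V := (ell2 R X).
Implicit Types (u v w : V) (F G : {fset X}).

(* Conjugate-linear in the first argument. *)
Definition ell2_inner u v : R[i] :=
  summability.sum (fun x => Num.conj (u x) * v x : R[i]^o).

Lemma polarization (a b : R[i]) : Num.conj a * b =
  4^-1 * ((normc (a + b) ^+ 2)%:C%C + (-1) * (normc (a - b) ^+ 2)%:C%C
    + (- 'i%C) * (normc (a + 'i%C * b) ^+ 2)%:C%C
    + 'i%C * (normc (a - 'i%C * b) ^+ 2)%:C%C).
Proof.
have sq (z : R[i]) : normc z ^+ 2 = complex.Re z ^+ 2 + complex.Im z ^+ 2.
  by case: z => p q /=; rewrite sqr_sqrtr ?addr_ge0 ?sqr_ge0.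
apply: (@mulfI _ 4); first by rewrite pnatr_eq0.
rewrite [RHS]mulrA mulfV ?pnatr_eq0// mul1r !sq.
have -> : (4 : R[i]) = (4 : R)%:C%C by rewrite rmorph_nat.
case: a b => a1 a2 [b1 b2]; rewrite -[Num.conj _]/(a1 -i* a2)%C.
by apply/eqP; rewrite eq_complex/=; apply/andP; split; apply/eqP; ring.
Qed.

Lemma ell2_innerP u v : is_sum (fun x => Num.conj (u x) * v x) (ell2_inner u v).
Proof.
suff [l lP] : exists l, is_sum (fun x => Num.conj (u x) * v x) l.
  by rewrite /ell2_inner (sumE lP).
eexists; apply: eq_is_sum; first by move=> x; rewrite polarization.
apply: is_sumZ; apply: is_sumD; [apply: is_sumD; [apply: is_sumD|]|].
- exact: (is_sum_sqr (u + v)).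
- apply: is_sumZ; exact: (is_sum_sqr (u - v)).
- apply: is_sumZ; exact: (is_sum_sqr (u + ('i%C : R[i]) *: v)).
- apply: is_sumZ; exact: (is_sum_sqr (u - ('i%C : R[i]) *: v)).
Qed.

Lemma innerC u v : ell2_inner u v = Num.conj (ell2_inner v u).
Proof.
apply: is_sum_uniq (ell2_innerP u v) _.
apply: eq_is_sum (is_sum_conj (ell2_innerP v u)) => x.
by rewrite rmorphM/= conjCK mulrC.
Qed.

Lemma innerDr u v w : ell2_inner u (v + w) = ell2_inner u v + ell2_inner u w.
Proof.
apply: is_sum_uniq (ell2_innerP u _) _.
apply: eq_is_sum (is_sumD (ell2_innerP u v) (ell2_innerP u w)) => x.
by rewrite mulrDr.
Qed.

Lemma innerZr (k : R[i]) u v : ell2_inner u (k *: v) = k * ell2_inner u v.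
Proof.
apply: is_sum_uniq (ell2_innerP u _) _.
by apply: eq_is_sum (is_sumZ k (ell2_innerP u v)) => x; rewrite mulrCA.
Qed.

Lemma innerDl u v w : ell2_inner (u + v) w = ell2_inner u w + ell2_inner v w.
Proof. by rewrite innerC innerDr rmorphD/= -!innerC. Qed.

Lemma innerZl (k : R[i]) u v : ell2_inner (k *: u) v = Num.conj k * ell2_inner u v.
Proof. by rewrite innerC innerZr rmorphM/= -innerC. Qed.

Lemma inner0r u : ell2_inner u 0 = 0.
Proof. by rewrite -(scale0r 0) innerZr mul0r. Qed.
Lemma inner0l u : ell2_inner 0 u = 0.
Proof. by rewrite innerC inner0r rmorph0. Qed.
Lemma innerNr u v : ell2_inner u (- v) = - ell2_inner u v.
Proof. by rewrite -scaleN1r innerZr mulN1r. Qed.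
Lemma innerNl u v : ell2_inner (- u) v = - ell2_inner u v.
Proof. by rewrite innerC innerNr rmorphN/= -innerC. Qed.
Lemma innerBl u v w : ell2_inner (u - v) w = ell2_inner u w - ell2_inner v w.
Proof. by rewrite innerDl innerNl. Qed.
Lemma innerBr u v w : ell2_inner u (v - w) = ell2_inner u v - ell2_inner u w.
Proof. by rewrite innerDr innerNr. Qed.
Lemma inner_suml I (s : seq I) (f : I -> V) v :
  ell2_inner (\sum_(i <- s) f i) v = \sum_(i <- s) ell2_inner (f i) v.
Proof.
by elim: s => [|i s IH]; rewrite ?big_nil ?inner0l// !big_cons innerDl IH.
Qed.

Lemma inner_uu u : ell2_inner u u = (l2norm u ^+ 2)%:C%C.
Proof.
apply: is_sum_uniq (ell2_innerP u u) _.
apply: eq_is_sum (is_sum_sqr u) => x.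
by rewrite mulrC -normCK normcE rmorphXn.
Qed.

Lemma CauchySchwarz u v : normc (ell2_inner u v) <= l2norm u * l2norm v.
Proof.
apply: is_sum_le (ell2_innerP u v) => F.
apply: le_trans (normc_sum _ _) _.
under eq_bigr do rewrite normcM normc_conj.
apply: le_trans (pnorm_CS _ _ _) _.
by rewrite ler_pM ?pnorm_ge0 ?pnorm_le.
Qed.

Lemma inner_ext u v : (forall w, ell2_inner w u = ell2_inner w v) -> u = v.
Proof.
move=> h; apply/eqP; rewrite -subr_eq0; apply/eqP; apply: l2norm0_eq0.
apply/eqP; rewrite -sqrf_eq0; apply/eqP.
have : ell2_inner (u - v) (u - v) = 0 by rewrite innerBr h subrr.
by rewrite inner_uu => -[].
Qed.

Fact delta_subproof (a : X) F : pnorm (fun x => (x == a)%:R : R[i]) F <= 1.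
Proof.
have [aF|aF] := boolP (a \in F); last first.
  rewrite (@eq_pnorm _ _ _ (fun=> 0)) ?pnorm0// => x xF.
  by case: eqVneq => // xa; rewrite -xa xF in aF.
rewrite pnorm_leP// expr1n /psum (big_fsetD1 a)//= eqxx.
rewrite [X in _ + X]big1_fset ?addr0 => [|x]; last first.
  by rewrite !inE => /andP[/negPf -> _] _; rewrite normc0 expr0n.
by rewrite normc1 expr1n.
Qed.

Definition ell2_delta (a : X) : V := mkell2 (delta_subproof a).

Fact restr_subproof F u G : pnorm (fun x => if x \in F then u x else 0) G <= l2norm u.
Proof.
apply: le_trans (pnorm_le u G); rewrite ler_wsqrtr// /psum.
apply: ler_sum => x _; case: ifP => // _; by rewrite normc0 expr0n/= sqr_ge0.
Qed.

Definition restr F u : V := mkell2 (restr_subproof F u).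

Lemma restrE F u x : restr F u x = if x \in F then u x else 0. Proof. by []. Qed.

Lemma restr_sum F u : restr F u = \sum_(a <- F) u a *: ell2_delta a.
Proof.
apply: ell2P => x; rewrite restrE ell2_sumE/=.
have [xF|xF] := boolP (x \in F).
  rewrite (big_fsetD1 x)//= eqxx mulr1 big1_fset ?addr0// => a.
  by rewrite !inE eq_sym => /andP[/negPf -> _] _; rewrite mulr0.
rewrite big_seq big1// => a aF; case: eqVneq; rewrite ?mulr0// => xa.
by rewrite xa aF in xF.
Qed.

Lemma l2norm_restr F u : l2norm (restr F u) = pnorm u F.
Proof.
apply/eqP; rewrite eq_le; apply/andP; split.
  apply: l2norm_le => [|G]; first exact: pnorm_ge0.
  rewrite ler_wsqrtr// /psum.
  rewrite (big_fsetID _ (fun x => x \in F))/= [X in _ + X]big1_fset ?addr0; last first.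
    move=> x; rewrite !inE => /andP[_ /negPf ->] _; by rewrite normc0 expr0n.
  apply: (@le_trans _ _ (psum u [fset x in G | x \in F]%fset)).
    by rewrite /psum !big_seq ler_sum// => x; rewrite !inE => /andP[_ ->].
  by apply: psumS; apply/fsubsetP => x; rewrite !inE => /andP[].
apply: le_trans (pnorm_le (restr F u) F).
by rewrite (@eq_pnorm _ _ _ u)// => x xF; rewrite restrE xF.
Qed.

Lemma restr_le F u : l2norm (restr F u) <= l2norm u.
Proof. by rewrite l2norm_restr pnorm_le. Qed.

Lemma corestr_sqr F u : l2norm (u - restr F u) ^+ 2 = l2norm u ^+ 2 - psum u F.
Proof.
apply: complexI; rewrite rmorphB -!inner_uu innerBr.
have -> : ell2_inner (u - restr F u) (restr F u) = 0.
  apply: is_sum_uniq (ell2_innerP _ _) _ => e e0; exists fset0 => B _.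
  rewrite big1 ?subrr ?normc0 ?ltW// => x _.
  rewrite ell2BE restrE; case: ifP => _; last by rewrite mulr0.
  by rewrite subrr rmorph0 mul0r.
rewrite subr0 innerC innerBr rmorphB/= -!innerC; congr (_ - _).
  by rewrite -inner_uu.
have -> : ell2_inner (restr F u) u = ell2_inner (restr F u) (restr F u).
  apply: is_sum_uniq (ell2_innerP _ _) _.
  apply: eq_is_sum (ell2_innerP _ _) => x.
  by rewrite restrE; case: ifP => _ //; rewrite rmorph0 !mul0r.
by rewrite inner_uu l2norm_restr pnorm_sqr.
Qed.

Lemma restr_cvg u (e : R) : 0 < e ->
  exists A : {fset X}, forall B, (A `<=` B)%fset -> l2norm (u - restr B u) <= e.
Proof.
move=> e0; have [A AP] := is_sum_sqr u (exprn_gt0 2 e0).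
exists A => B /AP; rewrite -rmorph_sum -rmorphB normc_real => h.
rewrite -(@ler_pXn2r _ 2)// ?nnegrE ?l2norm_ge0 ?(ltW e0)// corestr_sqr.
by rewrite /psum (le_trans _ h)// ler_norm.
Qed.

Lemma corestr_le F u : l2norm (u - restr F u) <= l2norm u.
Proof.
rewrite -(@ler_pXn2r _ 2)// ?nnegrE ?l2norm_ge0// corestr_sqr gerBl.
exact: psum_ge0.
Qed.

Lemma innerrestr F u v : ell2_inner (restr F u) v = ell2_inner u (restr F v).
Proof.
apply: is_sum_uniq (ell2_innerP _ _) _.
apply: eq_is_sum (ell2_innerP _ _) => x.
by rewrite !restrE; case: ifP => _ //; rewrite rmorph0 !(mul0r, mulr0).
Qed.

Lemma inner_delta a u : ell2_inner (ell2_delta a) u = u a.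
Proof.
apply: is_sum_uniq (ell2_innerP _ _) _ => e e0; exists [fset a]%fset => B.
rewrite fsub1set => aB; rewrite (big_fsetD1 a)//= eqxx rmorph1 mul1r.
rewrite big1_fset ?addr0 ?subrr ?normc0 ?ltW// => x.
by rewrite !inE => /andP[/negPf -> _] _; rewrite rmorph0 mul0r.
Qed.

End inner.

Record bop (R : realType) (X : choiceType) := Bop {
  bop_fun :> ell2 R X -> ell2 R X ;
  bop_linear : linear bop_fun ;
  bop_bounded : exists M : R, forall u, l2norm (bop_fun u) <= M * l2norm u
}.

Section bop_algebra.
Variables (R : realType) (X : choiceType).
Local Notation V := (ell2 R X).
Local Notation B := (bop R X).
Implicit Types (u v w : V) (S T U : B) (k : R[i]).

HB.instance Definition _ := gen_eqMixin B.
HB.instance Definition _ := gen_choiceMixin B.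

Lemma bopP S T : (forall u, S u = T u) -> S = T.
Proof.
case: S T => [S lS bS] [T lT bT]/= /funext e; subst T.
congr Bop; exact: Prop_irrelevance.
Qed.

Lemma bopD T u v : T (u + v) = T u + T v.
Proof. by have := bop_linear T 1 u v; rewrite !scale1r. Qed.
Lemma bop0 T : T 0 = 0.
Proof. by apply: (@addrI _ (T 0)); rewrite -bopD !addr0. Qed.
Lemma bopZ T k u : T (k *: u) = k *: T u.
Proof. by have := bop_linear T k u 0; rewrite bop0 !addr0. Qed.
Lemma bopN T u : T (- u) = - T u.
Proof. by rewrite -scaleN1r bopZ scaleN1r. Qed.
Lemma bopB T u v : T (u - v) = T u - T v.
Proof. by rewrite bopD bopN. Qed.
Lemma bop_sum T I (s : seq I) (f : I -> V) :
  T (\sum_(i <- s) f i) = \sum_(i <- s) T (f i).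
Proof. by elim: s => [|i s IH]; rewrite ?big_nil ?bop0// !big_cons bopD IH. Qed.

Definition opnorm T : R := sup [set l2norm (T u) | u in [set u | l2norm u <= 1]].

Lemma opnorm_has_sup T : has_sup [set l2norm (T u) | u in [set u | l2norm u <= 1]].
Proof.
split; first by exists (l2norm (T 0)); exists 0 => //=; rewrite l2norm0.
have [M MP] := bop_bounded T; exists `|M| => _ [u /= u1 <-].
apply: le_trans (MP u) _; apply: (@le_trans _ _ (`|M| * l2norm u)).
  by rewrite ler_wpM2r ?l2norm_ge0// ler_norm.
by rewrite ler_piMr.
Qed.

Lemma opnorm_ge0 T : 0 <= opnorm T.
Proof.
apply: le_trans (l2norm_ge0 (T 0)) _.
by apply: sup_upper_bound (opnorm_has_sup T) _ _; exists 0 => //=; rewrite l2norm0.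
Qed.

Lemma opnormP T u : l2norm (T u) <= opnorm T * l2norm u.
Proof.
have [u0|u0] := eqVneq (l2norm u) 0.
  by rewrite (l2norm0_eq0 u0) bop0 !l2norm0 mulr0.
have up : 0 < l2norm u by rewrite lt_neqAle eq_sym u0 l2norm_ge0.
pose k : R[i] := (l2norm u)^-1%:C%C.
have nk : normc k = (l2norm u)^-1 by rewrite normc_real ger0_norm// invr_ge0 ltW.
rewrite -ler_pdivrMr// mulrC -nk -l2normZ -bopZ.
apply: sup_upper_bound (opnorm_has_sup T) _ _; exists (k *: u) => //=.
by rewrite l2normZ nk mulVf.
Qed.

Lemma opnorm_le T (c : R) : 0 <= c ->
  (forall u, l2norm (T u) <= c * l2norm u) -> opnorm T <= c.
Proof.
move=> c0 h; apply: ge_sup; first exact: (opnorm_has_sup T).1.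
move=> _ [u /= u1 <-]; apply: le_trans (h u) _; by rewrite ler_piMr.
Qed.

Fact bop_zero_lin : linear (fun _ : V => 0 : V).
Proof. by move=> k u v; rewrite scaler0 addr0. Qed.
Fact bop_zero_bnd : exists M : R, forall u : V, l2norm (0 : V) <= M * l2norm u.
Proof. by exists 0 => u; rewrite mul0r l2norm0. Qed.
Definition bop_zero : B := Bop bop_zero_lin bop_zero_bnd.

Fact bop_one_lin : linear (fun u : V => u). Proof. by []. Qed.
Fact bop_one_bnd : exists M : R, forall u : V, l2norm u <= M * l2norm u.
Proof. by exists 1 => u; rewrite mul1r. Qed.
Definition bop_one : B := Bop bop_one_lin bop_one_bnd.

Fact bop_add_lin S T : linear (fun u => S u + T u).
Proof. by move=> k u v; rewrite !bop_linear scalerDr addrACA. Qed.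
Fact bop_add_le S T u : l2norm (S u + T u) <= (opnorm S + opnorm T) * l2norm u.
Proof. by rewrite mulrDl (le_trans (l2normD _ _))// lerD// opnormP. Qed.
Fact bop_add_bnd S T : exists M : R, forall u, l2norm (S u + T u) <= M * l2norm u.
Proof. exists (opnorm S + opnorm T); exact: bop_add_le. Qed.
Definition bop_add S T : B := Bop (bop_add_lin S T) (bop_add_bnd S T).

Fact bop_opp_lin T : linear (fun u => - T u).
Proof. by move=> k u v; rewrite bop_linear opprD scalerN. Qed.
Fact bop_opp_bnd T : exists M : R, forall u, l2norm (- T u) <= M * l2norm u.
Proof. by exists (opnorm T) => u; rewrite l2normN opnormP. Qed.
Definition bop_opp T : B := Bop (bop_opp_lin T) (bop_opp_bnd T).

Fact bop_scale_lin k T : linear (fun u => k *: T u).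
Proof. by move=> a u v; rewrite bop_linear scalerDr !scalerA mulrC. Qed.
Fact bop_scale_le k T u : l2norm (k *: T u) <= (normc k * opnorm T) * l2norm u.
Proof. by rewrite l2normZ -mulrA ler_wpM2l ?normc_ge0// opnormP. Qed.
Fact bop_scale_bnd k T : exists M : R, forall u, l2norm (k *: T u) <= M * l2norm u.
Proof. exists (normc k * opnorm T); exact: bop_scale_le. Qed.
Definition bop_scale k T : B := Bop (bop_scale_lin k T) (bop_scale_bnd k T).

Fact bop_mul_lin S T : linear (fun u => S (T u)).
Proof. by move=> k u v; rewrite !bop_linear. Qed.
Fact bop_mul_le S T u : l2norm (S (T u)) <= (opnorm S * opnorm T) * l2norm u.
Proof.
by rewrite (le_trans (opnormP _ _))// -mulrA ler_wpM2l ?opnorm_ge0// opnormP.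
Qed.
Fact bop_mul_bnd S T : exists M : R, forall u, l2norm (S (T u)) <= M * l2norm u.
Proof. exists (opnorm S * opnorm T); exact: bop_mul_le. Qed.
Definition bop_mul S T : B := Bop (bop_mul_lin S T) (bop_mul_bnd S T).

Fact bop_addA : associative bop_add.
Proof. by move=> S T U; apply: bopP => u /=; rewrite addrA. Qed.
Fact bop_addC : commutative bop_add.
Proof. by move=> S T; apply: bopP => u /=; rewrite addrC. Qed.
Fact bop_add0 : left_id bop_zero bop_add.
Proof. by move=> S; apply: bopP => u /=; rewrite add0r. Qed.
Fact bop_addN : left_inverse bop_zero bop_opp bop_add.
Proof. by move=> S; apply: bopP => u /=; rewrite addNr. Qed.

HB.instance Definition _ :=
  GRing.isZmodule.Build B bop_addA bop_addC bop_add0 bop_addN.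

Fact bop_scaleA a b T : bop_scale a (bop_scale b T) = bop_scale (a * b) T.
Proof. by apply: bopP => u /=; rewrite scalerA. Qed.
Fact bop_scale1 : left_id 1 bop_scale.
Proof. by move=> T; apply: bopP => u /=; rewrite scale1r. Qed.
Fact bop_scaleDr : right_distributive bop_scale +%R.
Proof. by move=> k S T; apply: bopP => u /=; rewrite scalerDr. Qed.
Fact bop_scaleDl T : {morph bop_scale^~ T : a b / a + b}.
Proof. by move=> a b; apply: bopP => u /=; rewrite scalerDl. Qed.

HB.instance Definition _ := GRing.Zmodule_isLmodule.Build R[i] B
  bop_scaleA bop_scale1 bop_scaleDr bop_scaleDl.

Lemma bopDE S T u : (S + T) u = S u + T u. Proof. by []. Qed.
Lemma bopNE T u : (- T) u = - T u. Proof. by []. Qed.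
Lemma bopBE S T u : (S - T) u = S u - T u. Proof. by []. Qed.
Lemma bopZE k T u : (k *: T) u = k *: T u. Proof. by []. Qed.

Lemma opnormD S T : opnorm (S + T) <= opnorm S + opnorm T.
Proof.
apply: opnorm_le; first by rewrite addr_ge0 ?opnorm_ge0.
exact: bop_add_le.
Qed.
Lemma opnorm0_eq0 T : opnorm T = 0 -> T = 0.
Proof.
move=> T0; apply: bopP => u; apply: l2norm0_eq0.
by apply/eqP; rewrite eq_le l2norm_ge0 andbT (le_trans (opnormP _ _))// T0 mul0r.
Qed.
Lemma opnormZ_le k T : opnorm (k *: T) <= normc k * opnorm T.
Proof.
apply: opnorm_le; first by rewrite mulr_ge0 ?opnorm_ge0 ?normc_ge0.
exact: bop_scale_le.
Qed.
Lemma opnormZ k T : opnorm (k *: T) = normc k * opnorm T.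
Proof.
apply/eqP; rewrite eq_le opnormZ_le/=.
have [->|k0] := eqVneq k 0; first by rewrite normc0 mul0r opnorm_ge0.
have nk : 0 < normc k.
  rewrite lt_neqAle normc_ge0 andbT eq_sym.
  by apply: contra k0 => /eqP/eq0_normc ->.
rewrite -ler_pdivlMl// -normcV.
by have := opnormZ_le k^-1 (k *: T); rewrite scalerA mulVf// scale1r.
Qed.

Fact bop_normD S T : (opnorm (S + T))%:C%C <= (opnorm S)%:C%C + (opnorm T)%:C%C :> R[i].
Proof. by rewrite -rmorphD lecR opnormD. Qed.
Fact bop_normZ k T : (opnorm (k *: T))%:C%C = `|k| * (opnorm T)%:C%C :> R[i].
Proof. by rewrite opnormZ rmorphM. Qed.
Fact bop_norm0 T : (opnorm T)%:C%C = 0 :> R[i] -> T = 0.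
Proof. by move=> [] /opnorm0_eq0. Qed.

HB.instance Definition _ := Lmodule_isNormed.Build R[i] B
  bop_normD bop_normZ bop_norm0.

Lemma bop_normE T : `|T| = (opnorm T)%:C%C. Proof. by []. Qed.
Lemma opnorm0 : opnorm 0 = 0.
Proof. by have [] : `|0 : B| = 0 by rewrite normr0. Qed.
Lemma opnormN T : opnorm (- T) = opnorm T.
Proof. by have [] : `|- T| = `|T| by rewrite normrN. Qed.
Lemma opnorm_distC S T : opnorm (S - T) = opnorm (T - S).
Proof. by rewrite -opnormN opprB. Qed.
Lemma opnormM S T : opnorm (bop_mul S T) <= opnorm S * opnorm T.
Proof.
apply: opnorm_le; first by rewrite mulr_ge0 ?opnorm_ge0.
exact: bop_mul_le.
Qed.

Lemma le0_small (x c : R) : (forall e : R, 0 < e -> x <= e * c) -> x <= 0.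
Proof.
move=> h; apply/ler_addgt0Pr => e e0; rewrite add0r.
have c1 : 0 < `|c| + 1 by rewrite ltr_wpDl.
apply: le_trans (h (e / (`|c| + 1)) (divr_gt0 e0 c1)) _.
rewrite mulrAC ler_pdivrMr// ler_wpM2l ?(ltW e0)//.
by rewrite (le_trans (ler_norm c))// lerDl.
Qed.

Lemma bop_seq_cvg (T : nat -> B) :
  (forall n m, (n <= m)%N -> opnorm (T n - T m) <= 2^-1 ^+ n) ->
  exists L, forall n, opnorm (T n - L) <= 2^-1 ^+ n.
Proof.
move=> Tc.
have i2 n : 0 <= (2^-1 ^+ n : R) by rewrite exprn_ge0// invr_ge0.
have ex u : exists l, forall n, l2norm (T n u - l) <= 2^-1 ^+ n * l2norm u.
  apply: (@ell2_seq_cvg _ _ (fun n => T n u)) => [n m nm|n m nm|e e0].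
  - rewrite -bopBE (le_trans (opnormP _ _))// ler_wpM2r ?l2norm_ge0//; exact: Tc.
  - by rewrite ler_wpM2r ?l2norm_ge0// half_mono.
  - have u1 : 0 < l2norm u + 1 by rewrite ltr_wpDl ?l2norm_ge0.
    have [N NP] := half_small (divr_gt0 e0 u1); exists N.
    rewrite ler_pdivlMr// in NP; apply: le_trans NP.
    by rewrite ler_wpM2l// lerDl.
pose L u := projT1 (cid (ex u)).
have LP u n : l2norm (T n u - L u) <= 2^-1 ^+ n * l2norm u by exact: projT2 (cid (ex u)) n.
have L_lin : linear L.
  move=> k u v; apply/eqP; rewrite -subr_eq0; apply/eqP/l2norm0_eq0.
  apply/eqP; rewrite eq_le l2norm_ge0 andbT.
  apply: (@le0_small _ (l2norm (k *: u + v) + normc k * l2norm u + l2norm v)) => e.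
  move=> /half_small[n ne].
  have -> : L (k *: u + v) - (k *: L u + L v) =
     - (T n (k *: u + v) - L (k *: u + v)) + k *: (T n u - L u) + (T n v - L v).
    rewrite bop_linear scalerBr opprB; apply: ell2P => x.
    by rewrite !(ell2BE, ell2DE, ell2ZE, ell2NE); ring.
  apply: (@le_trans _ _ (2^-1 ^+ n * (l2norm (k *: u + v) + normc k * l2norm u + l2norm v))).
    rewrite !mulrDr (le_trans (l2normD _ _))// lerD// (le_trans (l2normD _ _))// lerD//.
      by rewrite l2normN.
    by rewrite l2normZ mulrCA ler_wpM2l ?normc_ge0.
  rewrite ler_wpM2r// !addr_ge0 ?l2norm_ge0// mulr_ge0 ?normc_ge0 ?l2norm_ge0//.
have L_bnd : exists M : R, forall u, l2norm (L u) <= M * l2norm u.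
  exists (opnorm (T 0%N) + 1) => u; rewrite mulrDl.
  have -> : L u = T 0%N u - (T 0%N u - L u) by rewrite opprB addrC subrK.
  apply: le_trans (l2normB _ _) _; apply: lerD; first exact: opnormP.
  by have := LP u 0%N; rewrite expr0.
exists (Bop L_lin L_bnd) => n; apply: opnorm_le (i2 n) _ => u /=; exact: LP.
Qed.

Lemma bop_complete (F : set_system B) : ProperFilter F -> cauchy F -> cvg F.
Proof.
apply: (complete_criterion bop_normE) => T Tc.
have [L LP] := bop_seq_cvg Tc.
exists L => e /half_small[N NP]; exists N => n Nn.
by rewrite (le_trans (LP n))// (le_trans (half_mono _ Nn)).
Qed.

HB.instance Definition _ := Uniform_isComplete.Build B bop_complete.

(* <T delta_a, v> is the a-th coordinate of the adjoint of T applied to v. *)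
Definition bop_adj_fun T v (a : X) : R[i] := ell2_inner (T (ell2_delta R a)) v.

Fact bop_adj_subproof T v F : pnorm (bop_adj_fun T v) F <= opnorm T * l2norm v.
Proof.
set p := pnorm _ F.
pose f a := if a \in F then bop_adj_fun T v a else 0.
have fb G : pnorm f G <= \sum_(x <- F) normc (bop_adj_fun T v x).
  rewrite (le_trans _ (pnorm_sum _ _))// ler_wsqrtr//.
  rewrite /psum (big_fsetID _ (fun x => x \in F))/= [X in _ + X]big1_fset ?addr0; last first.
    move=> x; rewrite !inE => /andP[_ /negPf xF] _; by rewrite /f xF normc0 expr0n.
  apply: (@le_trans _ _ (psum (bop_adj_fun T v) [fset x in G | x \in F]%fset)).
    by rewrite /psum !big_seq ler_sum// => x; rewrite !inE /f => /andP[_ ->].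
  by apply: psumS; apply/fsubsetP => x; rewrite !inE => /andP[].
pose w := mkell2 fb.
have wE : w = restr F w.
  by apply: ell2P => x; rewrite restrE /= /f; case: ifP.
have wn : l2norm w = p.
  rewrite wE l2norm_restr; apply: eq_pnorm => x xF; by rewrite /= /f xF.
have key : (p ^+ 2)%:C%C = ell2_inner (T w) v.
  rewrite wE restr_sum bop_sum inner_suml pnorm_sqr /psum rmorph_sum.
  rewrite !big_seq; apply: eq_bigr => a aF.
  rewrite bopZ innerZl -[ell2_inner _ _]/(bop_adj_fun T v a) /= /f aF.
  by rewrite mulrC -normCK normcE rmorphXn.
have p0 : 0 <= p by exact: pnorm_ge0.
have : p ^+ 2 <= opnorm T * l2norm v * p.
  rewrite -[leLHS]ger0_norm ?sqr_ge0// -normc_real key.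
  rewrite (le_trans (CauchySchwarz _ _))// mulrAC ler_wpM2r ?l2norm_ge0// -wn.
  exact: opnormP.
have [->|pn0] := eqVneq p 0; first by rewrite mulr_ge0 ?opnorm_ge0 ?l2norm_ge0.
by rewrite expr2 ler_pM2r// lt_neqAle eq_sym pn0.
Qed.

Definition bop_adj_val T v : V := mkell2 (bop_adj_subproof T v).

Lemma bop_adj_bound T v : l2norm (bop_adj_val T v) <= opnorm T * l2norm v.
Proof.
apply: l2norm_le; first by rewrite mulr_ge0 ?opnorm_ge0 ?l2norm_ge0.
exact: bop_adj_subproof.
Qed.

Fact bop_adj_lin T : linear (bop_adj_val T).
Proof.
by move=> k u v; apply: ell2P => x; rewrite ell2DE ell2ZE/= /bop_adj_fun innerDr innerZr.
Qed.
Fact bop_adj_bnd T : exists M : R, forall u, l2norm (bop_adj_val T u) <= M * l2norm u.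
Proof. exists (opnorm T); exact: bop_adj_bound. Qed.
Definition bop_adj T : B := Bop (bop_adj_lin T) (bop_adj_bnd T).

Lemma bop_adjE T u v : ell2_inner (T u) v = ell2_inner u (bop_adj T v).
Proof.
apply/eqP; rewrite -subr_eq0; apply/eqP/eq0_normc/eqP.
rewrite eq_le normc_ge0 andbT.
apply: (@le0_small _ (opnorm T * l2norm v + l2norm (bop_adj T v))) => e /(@restr_cvg _ _ u)[A].
move=> /(_ A (fsubset_refl _)) h.
have eqA : ell2_inner (T (restr A u)) v = ell2_inner (restr A u) (bop_adj T v).
  rewrite restr_sum bop_sum !inner_suml; apply: eq_bigr => a _.
  by rewrite bopZ !innerZl inner_delta.
have -> : ell2_inner (T u) v - ell2_inner u (bop_adj T v) =
   ell2_inner (T (u - restr A u)) v - ell2_inner (u - restr A u) (bop_adj T v).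
  by rewrite bopB !innerBl eqA; ring.
rewrite mulrDr (le_trans (ler_normcD _ _))// normcN lerD//.
  rewrite (le_trans (CauchySchwarz _ _))// mulrA ler_wpM2r ?l2norm_ge0//.
  by rewrite (le_trans (opnormP _ _))// mulrC ler_wpM2r// opnorm_ge0.
by rewrite (le_trans (CauchySchwarz _ _))// ler_wpM2r ?l2norm_ge0.
Qed.

Lemma bop_adj_uniq S T : (forall u v, ell2_inner (T u) v = ell2_inner u (S v)) ->
  S = bop_adj T.
Proof.
by move=> h; apply: bopP => v; apply: inner_ext => w; rewrite -h -bop_adjE.
Qed.

Lemma bop_adjE2 T u v : ell2_inner (bop_adj T u) v = ell2_inner u (T v).
Proof. by rewrite innerC -bop_adjE -innerC. Qed.

Lemma bop_adjK : involutive bop_adj.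
Proof. by move=> T; apply/esym/bop_adj_uniq => u v; rewrite bop_adjE2. Qed.

Lemma bop_adjD S T : bop_adj (S + T) = bop_adj S + bop_adj T.
Proof.
apply/esym/bop_adj_uniq => u v.
by rewrite !bopDE innerDl innerDr !bop_adjE.
Qed.

Lemma bop_adjZ k T : bop_adj (k *: T) = Num.conj k *: bop_adj T.
Proof.
apply/esym/bop_adj_uniq => u v.
by rewrite !bopZE innerZl innerZr bop_adjE.
Qed.

Lemma bop_adjM S T : bop_adj (bop_mul S T) = bop_mul (bop_adj T) (bop_adj S).
Proof. by apply/esym/bop_adj_uniq => u v /=; rewrite !bop_adjE. Qed.

Lemma opnorm_adj_le T : opnorm (bop_adj T) <= opnorm T.
Proof. apply: opnorm_le (opnorm_ge0 T) _; exact: bop_adj_bound. Qed.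

Lemma opnorm_adj T : opnorm (bop_adj T) = opnorm T.
Proof.
apply/eqP; rewrite eq_le opnorm_adj_le/=.
by rewrite -{1}(bop_adjK T) opnorm_adj_le.
Qed.

Lemma opnorm_cstar T : opnorm (bop_mul (bop_adj T) T) = opnorm T ^+ 2.
Proof.
apply/eqP; rewrite eq_le; apply/andP; split.
  by rewrite (le_trans (opnormM _ _))// opnorm_adj expr2.
set c := opnorm (bop_mul _ _).
have c0 : 0 <= c by exact: opnorm_ge0.
rewrite -[leRHS]sqr_sqrtr// ler_pXn2r ?nnegrE ?opnorm_ge0 ?sqrtr_ge0//.
apply: opnorm_le; first exact: sqrtr_ge0.
move=> u; rewrite -(@ler_pXn2r _ 2)// ?nnegrE ?mulr_ge0 ?l2norm_ge0 ?sqrtr_ge0//.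
rewrite exprMn (sqr_sqrtr c0) -[leLHS]ger0_norm ?sqr_ge0// -normc_real -inner_uu.
rewrite bop_adjE (le_trans (CauchySchwarz _ _))// mulrC expr2 mulrA.
by rewrite ler_wpM2r ?l2norm_ge0//; exact: (opnormP (bop_mul (bop_adj T) T)).
Qed.

Fact bop_mulA : associative bop_mul. Proof. by move=> S T U; exact: bopP. Qed.
Fact bop_mul1x : left_id bop_one bop_mul. Proof. by move=> S; exact: bopP. Qed.
Fact bop_mulx1 : right_id bop_one bop_mul. Proof. by move=> S; exact: bopP. Qed.
Fact bop_mulDl : left_distributive bop_mul +%R.
Proof. by move=> S T U; exact: bopP. Qed.
Fact bop_mulDr : right_distributive bop_mul +%R.
Proof. by move=> S T U; apply: bopP => u /=; rewrite bopD. Qed.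
Fact bop_mulZl k S T : bop_mul (k *: S) T = k *: bop_mul S T.
Proof. exact: bopP. Qed.
Fact bop_mulZr k S T : bop_mul S (k *: T) = k *: bop_mul S T.
Proof. by apply: bopP => u /=; rewrite bopZ. Qed.
Fact bop_cnormM S T : `|bop_mul S T| <= `|S| * `|T|.
Proof. by rewrite !bop_normE -rmorphM lecR opnormM. Qed.
Fact bop_cstar T : `|bop_mul (bop_adj T) T| = `|T| ^+ 2.
Proof. by rewrite !bop_normE opnorm_cstar rmorphXn. Qed.

HB.instance Definition _ := CompleteNormedModule_isCstarAlgebra.Build R[i] B
  bop_mulA bop_mul1x bop_mulx1 bop_mulDl bop_mulDr bop_mulZl bop_mulZr
  bop_cnormM bop_adjD bop_adjZ bop_adjM bop_adjK bop_cstar.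

End bop_algebra.

Section compact_operators.
Variables (R : realType) (X : choiceType).
Local Notation V := (ell2 R X).
Local Notation B := (bop R X).
Implicit Types (u v w : V) (S T U : B) (k : R[i]) (F G : {fset X}).

Definition compact_op T : Prop := precompact (T @` [set u : V | `|u| <= 1]).

Lemma sqr_le_l2 u v : l2norm u ^+ 2 <= l2norm v ^+ 2 -> l2norm u <= l2norm v.
Proof.
move: (l2norm u) (l2norm v) (l2norm_ge0 u) (l2norm_ge0 v) => a b a0 b0.
by rewrite ler_pXn2r.
Qed.

(* Uniform approximability of T by finitely many coordinates; equivalent to
   compactness, see [compact_opP]. *)
Definition approx T := forall e : R, 0 < e -> exists F, forall u,
  l2norm (T u - restr F (T u)) <= e * l2norm u.

Lemma restrD F u v : restr F (u + v) = restr F u + restr F v.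
Proof.
by apply: ell2P => x; rewrite !(restrE, ell2DE); case: ifP; rewrite ?addr0.
Qed.
Lemma restrZ F k u : restr F (k *: u) = k *: restr F u.
Proof.
by apply: ell2P => x; rewrite !(restrE, ell2ZE); case: ifP; rewrite ?mulr0.
Qed.

Lemma restrB F u v : restr F (u - v) = restr F u - restr F v.
Proof. by rewrite (restrD F u (- v)) -(scaleN1r v) (restrZ F) scaleN1r. Qed.

Fact pr_lin F : linear (@restr R X F).
Proof. by move=> k u v; rewrite restrD restrZ. Qed.
Fact pr_bnd F : exists M : R, forall u, l2norm (restr F u) <= M * l2norm u.
Proof. by exists 1 => u; rewrite mul1r restr_le. Qed.
Definition pr F : B := Bop (pr_lin F) (pr_bnd F).

Definition tail F u := l2norm (u - restr F u).

Lemma tailD F u v : tail F (u + v) <= tail F u + tail F v.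
Proof. by rewrite /tail restrD opprD addrACA l2normD. Qed.
Lemma tailZ F k u : tail F (k *: u) = normc k * tail F u.
Proof. by rewrite /tail restrZ -scalerBr l2normZ. Qed.
Lemma tail_le F u : tail F u <= l2norm u.
Proof. exact: corestr_le. Qed.
Lemma tail_ge0 F u : 0 <= tail F u. Proof. exact: l2norm_ge0. Qed.
Lemma tailS F G u : (F `<=` G)%fset -> tail G u <= tail F u.
Proof.
move=> FG; apply: sqr_le_l2; rewrite (corestr_sqr G u) (corestr_sqr F u).
by rewrite lerD2l lerN2 psumS.
Qed.
Lemma tail_sum F I (s : seq I) (f : I -> V) :
  tail F (\sum_(i <- s) f i) <= \sum_(i <- s) tail F (f i).
Proof.
elim: s => [|i s IH]; last by rewrite !big_cons (le_trans (tailD _ _ _))// lerD2l.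
by rewrite !big_nil (le_trans (tail_le _ _))// l2norm0.
Qed.

Lemma compact_approx T : compact_op T -> approx T.
Proof.
rewrite /compact_op precompactE compact_cover => cT e e0.
have e20 : 0 < e / 2 by rewrite divr_gt0.
have e20c : 0 < (e / 2)%:C%C :> R[i] by rewrite ltcR.
set S := T @` _ in cT.
have [|v Sv|D _ DP] := cT V setT (fun v => (ball v (e / 2)%:C%C)^°).
- by move=> v _; exact: open_interior.
- exists v => //; exact: (nbhsx_ballx v _ e20c).
have tl v : exists F, tail F v <= e / 2.
  have [A AP] := restr_cvg v e20; exists A; exact: AP.
pose Fv v := projT1 (cid (tl v)).
have FvP v : tail (Fv v) v <= e / 2 by exact: projT2 (cid (tl v)).
pose F := (\bigcup_(v <- D) Fv v)%fset.
have key u : l2norm u <= 1 -> tail F (T u) <= e.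
  move=> u1; have /DP[v /= vD /interior_subset] : closure S (T u).
    by apply: subset_closure; exists u => //=; rewrite ell2_normE lecR.
  rewrite -ball_normE/= ell2_normE ltcR => uv.
  have -> : T u = v + - (v - T u) by rewrite opprB addrC subrK.
  rewrite (splitr e) (le_trans (tailD _ _ _))// lerD//.
    rewrite (le_trans _ (FvP v))// tailS//; exact: bigfcup_sup.
  by rewrite (le_trans (tail_le _ _))// l2normN ltW.
exists F => u; rewrite -/(tail _ _).
have [u0|u0] := eqVneq (l2norm u) 0.
  by rewrite (l2norm0_eq0 u0) bop0 (le_trans (tail_le _ _))// !l2norm0 mulr0.
have up : 0 < l2norm u by rewrite lt_neqAle eq_sym u0 l2norm_ge0.
have nk : normc ((l2norm u)^-1%:C%C : R[i]) = (l2norm u)^-1.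
  by rewrite normc_real ger0_norm// invr_ge0 ltW.
rewrite -ler_pdivrMr// mulrC -nk -tailZ -bopZ; apply: key.
by rewrite l2normZ nk mulVf.
Qed.

Lemma ultra_real (F : set_system V) (f : V -> R) (M : R) : UltraFilter F ->
  F [set v | `|f v| <= M] -> exists l, forall e, 0 < e -> F [set v | `|f v - l| <= e].
Proof.
move=> FU FM; have FP : ProperFilter F by exact: ultra_proper.
pose A := [set r | F [set v | r <= f v]].
have sA : has_sup A.
  split; first by exists (- M); apply: filterS FM => v /=; rewrite ler_norml => /andP[].
  exists M => r Ar; have [v [/= h1 h2]] := filter_ex (filterI FM Ar).
  by apply: le_trans h2 _; rewrite (le_trans (ler_norm _)).
exists (sup A) => e e0.
have [r Ar rA] := sup_adherent e0 sA.
have nA : F [set v | f v < sup A + e].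
  have [h|] := in_ultra_setVsetC [set v | sup A + e <= f v] FU.
    have /(sup_upper_bound sA) : A (sup A + e) by exact: h.
    by lra.
  by apply: filterS => v /= /negP; rewrite -ltNge.
near=> v => /=; rewrite ler_norml.
have h1 : r <= f v by near: v.
have h2 : f v < sup A + e by near: v.
by apply/andP; split; lra.
Unshelve. all: by end_near. Qed.

Lemma ultra_C (F : set_system V) (f : V -> R[i]) (M : R) : UltraFilter F ->
  F [set v | normc (f v) <= M] ->
  exists l, forall e : R, 0 < e -> F [set v | normc (f v - l) <= e].
Proof.
move=> FU FM; have FP : ProperFilter F by exact: ultra_proper.
have ReIm (z : R[i]) : [/\ `|complex.Re z| <= normc z, `|complex.Im z| <= normc z &
    normc z <= `|complex.Re z| + `|complex.Im z|].
  case: z => a b /=; rewrite -!sqrtr_sqr; split; try rewrite ler_wsqrtr//.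
  - by rewrite lerDl sqr_ge0.
  - by rewrite lerDr sqr_ge0.
  rewrite !sqrtr_sqr -[leRHS]ger0_norm ?addr_ge0// -[leRHS]sqrtr_sqr ler_wsqrtr//.
  have -> : (`|a| + `|b|) ^+ 2 = a ^+ 2 + b ^+ 2 + 2 * (`|a| * `|b|).
    by rewrite -[a ^+ 2]real_normK ?num_real// -[b ^+ 2]real_normK ?num_real//; ring.
  by rewrite lerDl !mulr_ge0.
have [|a aP] := @ultra_real F (fun v => complex.Re (f v)) M FU.
  by apply: filterS FM => v /=; apply: le_trans; have [] := ReIm (f v).
have [|b bP] := @ultra_real F (fun v => complex.Im (f v)) M FU.
  by apply: filterS FM => v /=; apply: le_trans; have [] := ReIm (f v).
exists (a +i* b)%C => e e0; have e20 : 0 < e / 2 by rewrite divr_gt0.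
near=> v => /=; have [_ _ h] := ReIm (f v - (a +i* b)%C); apply: le_trans h _.
have h1 : `|complex.Re (f v) - a| <= e / 2 by near: v; exact: aP.
have h2 : `|complex.Im (f v) - b| <= e / 2 by near: v; exact: bP.
by rewrite (splitr e); case: (f v) h1 h2 => p q /= h1 h2; exact: lerD.
Unshelve. all: by end_near. Qed.

Lemma approx_compact T : approx T -> compact_op T.
Proof.
move=> aT; rewrite /compact_op precompactE; set S := T @` _.
have clS v (e : R) : 0 < e -> closure S v ->
    exists2 u, l2norm u <= 1 & l2norm (v - T u) <= e.
  move=> e0 /(_ (ball v e%:C%C)) []; first by apply: nbhsx_ballx; rewrite ltcR.
  move=> _ [[u /= u1 <-]]; rewrite -ball_normE/= ell2_normE ltcR => /ltW h.
  by exists u => //; rewrite ell2_normE lecR in u1.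
have bnd v : closure S v -> l2norm v <= opnorm T + 1.
  move=> /(clS _ _ ltr01)[u u1 h].
  rewrite -(subrK (T u) v) addrC (le_trans (l2normD _ _))// lerD//.
  by rewrite (le_trans (opnormP _ _))// ler_piMr// opnorm_ge0.
have tl e : 0 < e -> exists F, forall v, closure S v -> tail F v <= e.
  move=> e0; have e20 : 0 < e / 2 by rewrite divr_gt0.
  have [F FP] := aT _ e20; exists F => v /(clS _ _ e20)[u u1 h].
  rewrite -(subrK (T u) v) (splitr e) (le_trans (tailD _ _ _))// lerD//.
    by rewrite (le_trans (tail_le _ _)).
  by rewrite (le_trans (FP u))// ler_piMr// ltW.
rewrite compact_ultra => F FU FS.
have FP : ProperFilter F by exact: ultra_proper.
suff : cauchy F.
  move=> /cauchy_cvg/cvg_ex[l Fl]; exists l; split => //.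
  exact: (@closed_cvg _ _ F FP id (closure S) (@closed_closure _ S) FS l Fl).
apply/cauchy_exP => _ /posc[e e0 ->].
have e20 : 0 < e / 4 by rewrite divr_gt0.
have [A AP] := tl _ e20.
have cx x : exists l, forall d : R, 0 < d -> F [set v : V | normc (v x - l) <= d].
  apply: (@ultra_C F (fun v => v x) (opnorm T + 1)) => //.
  by apply: filterS FS => v /bnd h /=; rewrite (le_trans (normc_le _ _)).
pose l x := projT1 (cid (cx x)).
have lP x d : 0 < d -> F [set v : V | normc (v x - l x) <= d] by exact: projT2 (cid (cx x)) d.
pose w : V := \sum_(a <- A) l a *: ell2_delta R a.
pose d : R := e / 4 / (#|` A|%:R + 1).
have n0 : 0 < #|` A|%:R + 1 :> R by rewrite ltr_wpDl.
have d0 : 0 < d by rewrite divr_gt0.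
exists w.
have near_all : F [set v : V | forall x, x \in A -> normc (v x - l x) <= d].
  suff h (s : seq X) : F [set v : V | forall x, x \in s -> normc (v x - l x) <= d].
    exact: h (enum_fset A).
  elim: s => [|x s IH]; first by apply: filterS filterT.
  apply: filterS (filterI (lP x d d0) IH) => v [h1 h2] y.
  by rewrite inE => /predU1P[->//|]; exact: h2.
apply: filterS (filterI FS near_all) => v [/AP vA vl].
rewrite -ball_normE/= ell2_normE ltcR.
have -> : w - v = (w - restr A v) + - (v - restr A v) by rewrite opprB addrA subrK.
apply: (@le_lt_trans _ _ (e / 4 + e / 4)); last by lra.
rewrite (le_trans (l2normD _ _))// l2normN lerD//.
have -> : w - restr A v = restr A (w - v).
  rewrite (restrB A w v); congr (_ - _); apply: ell2P => x; rewrite restrE; case: ifPn => // xA.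
  rewrite /w ell2_sumE big_seq big1// => a aA; rewrite ell2ZE/=.
  by case: eqVneq => [xa|]; rewrite ?mulr0//; rewrite xa aA in xA.
rewrite l2norm_restr (le_trans (pnorm_sum _ _))//.
apply: (@le_trans _ _ (\sum_(x <- A) d)).
  rewrite !big_seq ler_sum// => x xA; rewrite ell2BE -normcN opprB.
  rewrite (le_trans _ (vl _ xA))//.
  suff -> : w x = l x by [].
  rewrite /w ell2_sumE (big_fsetD1 x)//= eqxx mulr1 big1_fset ?addr0// => a.
  by rewrite !inE eq_sym => /andP[/negPf -> _] _; rewrite mulr0.
rewrite big_const_seq count_predT iter_addr_0 -[leLHS]mulr_natr /d -mulrA ler_piMr ?(ltW e20)//.
by rewrite mulrC ler_pdivrMr// mul1r lerDl.
Qed.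

Lemma compact_opP T : compact_op T <-> approx T.
Proof. by split; [exact: compact_approx|exact: approx_compact]. Qed.

Lemma approx_lim T : (forall e : R, 0 < e -> exists2 K, approx K & opnorm (T - K) <= e) ->
  approx T.
Proof.
move=> h e e0; have e20 : 0 < e / 2 by rewrite divr_gt0.
have [K aK TK] := h _ e20; have [F FP] := aK _ e20.
exists F => u; rewrite -/(tail _ _).
have -> : T u = (T - K) u + K u by rewrite bopBE subrK.
rewrite (splitr e) mulrDl (le_trans (tailD _ _ _))// lerD//; last exact: FP.
rewrite (le_trans (tail_le _ _))// (le_trans (opnormP _ _))//.
by rewrite ler_wpM2r ?l2norm_ge0.
Qed.

Lemma approx0 : approx 0.
Proof.
move=> e e0; exists fset0 => u; rewrite -/(tail _ _) (le_trans (tail_le _ _))//.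
by rewrite l2norm0 mulr_ge0 ?l2norm_ge0 ?ltW.
Qed.

Lemma approxD S T : approx S -> approx T -> approx (S + T).
Proof.
move=> aS aT e e0; have e20 : 0 < e / 2 by rewrite divr_gt0.
have [F FP] := aS _ e20; have [G GP] := aT _ e20.
exists (F `|` G)%fset => u; rewrite -/(tail _ _) bopDE (splitr e) mulrDl.
rewrite (le_trans (tailD _ _ _))// lerD//.
  by rewrite (le_trans (tailS _ (fsubsetUl F G)))//; exact: FP.
by rewrite (le_trans (tailS _ (fsubsetUr F G)))//; exact: GP.
Qed.

Lemma approxZ k T : approx T -> approx (k *: T).
Proof.
move=> aT e e0; have k0 : 0 < normc k + 1 by rewrite ltr_wpDl ?normc_ge0.
have [F FP] := aT _ (divr_gt0 e0 k0).
exists F => u; rewrite -/(tail _ _) bopZE tailZ.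
apply: (@le_trans _ _ ((normc k + 1) * tail F (T u))).
  by rewrite ler_wpM2r ?tail_ge0// lerDl.
rewrite -ler_pdivlMl// mulrCA mulrA mulrAC; rewrite (le_trans (FP u))//.
by rewrite mulrAC.
Qed.

Lemma approxN T : approx T -> approx (- T).
Proof. by rewrite -scaleN1r; exact: approxZ. Qed.

Lemma approxMr S T : approx S -> approx (bop_mul S T).
Proof.
move=> aS e e0; have T0 : 0 < opnorm T + 1 by rewrite ltr_wpDl ?opnorm_ge0.
have [F FP] := aS _ (divr_gt0 e0 T0).
exists F => u; rewrite (le_trans (FP _))// -mulrA ler_wpM2l ?(ltW e0)//.
rewrite ler_pdivrMl// (le_trans (opnormP _ _))// ler_wpM2r ?l2norm_ge0//.
by rewrite lerDl.
Qed.

Lemma approx_pr S F : approx (bop_mul S (pr F)).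
Proof.
move=> e e0.
have n0 : 0 < #|` F|%:R + 1 :> R by rewrite ltr_wpDl.
pose d : R := e / (#|` F|%:R + 1).
have d0 : 0 < d by rewrite divr_gt0.
have [G GP] : exists G, forall a, a \in F -> tail G (S (ell2_delta R a)) <= d.
  suff h (s : seq X) : exists G, forall a, a \in s -> tail G (S (ell2_delta R a)) <= d.
    exact: h (enum_fset F).
  elim: s => [|a s [G GP]]; first by exists fset0.
  have [A /(_ A (fsubset_refl _)) AP] := restr_cvg (S (ell2_delta R a)) d0.
  exists (A `|` G)%fset => b; rewrite inE => /predU1P[->|/GP h].
    by rewrite (le_trans (tailS _ (fsubsetUl _ _))).
  by rewrite (le_trans (tailS _ (fsubsetUr _ _))).
exists G => u; rewrite -/(tail _ _) /= restr_sum bop_sum (le_trans (tail_sum _ _ _))//.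
apply: (@le_trans _ _ (\sum_(a <- F) (d * l2norm u))).
  rewrite !big_seq ler_sum// => a aF; rewrite bopZ tailZ mulrC.
  by rewrite ler_pM ?tail_ge0 ?normc_ge0 ?GP ?normc_le.
rewrite big_const_seq count_predT iter_addr_0 -[leLHS]mulr_natr mulrAC ler_wpM2r ?l2norm_ge0//.
by rewrite /d -mulrA ler_piMr ?(ltW e0)// mulrC ler_pdivrMr// mul1r lerDl.
Qed.

Lemma approx_opnorm T : approx T -> forall e : R, 0 < e -> exists F,
  opnorm (T - bop_mul (pr F) T) <= e.
Proof.
by move=> aT e e0; have [F FP] := aT e e0; exists F; apply: opnorm_le (ltW e0) _.
Qed.

Lemma approxMl S T : approx T -> approx (bop_mul S T).
Proof.
move=> aT; apply: approx_lim => e e0.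
have S0 : 0 < opnorm S + 1 by rewrite ltr_wpDl ?opnorm_ge0.
have [F FP] := approx_opnorm aT (divr_gt0 e0 S0).
exists (bop_mul (bop_mul S (pr F)) T); first exact/approxMr/approx_pr.
have -> : bop_mul S T - bop_mul (bop_mul S (pr F)) T = bop_mul S (T - bop_mul (pr F) T).
  by apply: bopP => u; rewrite /= bopB.
rewrite (le_trans (opnormM _ _))// (@le_trans _ _ ((opnorm S + 1) * opnorm (T - bop_mul (pr F) T)))//.
  by rewrite ler_wpM2r ?opnorm_ge0// lerDl.
by rewrite -ler_pdivlMl// mulrC.
Qed.

Lemma adj_pr F : bop_adj (pr F) = pr F.
Proof. by apply/esym/bop_adj_uniq => u v; exact: innerrestr. Qed.

Lemma approx_adj T : approx T -> approx (bop_adj T).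
Proof.
move=> aT; apply: approx_lim => e e0.
have [F FP] := approx_opnorm aT e0.
exists (bop_mul (bop_adj T) (pr F)); first exact: approx_pr.
rewrite -opnorm_adj in FP; apply: le_trans FP.
suff -> : bop_adj (T - bop_mul (pr F) T) = bop_adj T - bop_mul (bop_adj T) (pr F) by [].
have -> : - bop_mul (pr F) T = (-1 : R[i]) *: bop_mul (pr F) T by rewrite scaleN1r.
by rewrite bop_adjD bop_adjZ bop_adjM adj_pr rmorphN rmorph1 scaleN1r.
Qed.

Definition compact_ops : {pred B} := fun T => `[< compact_op T >].

Lemma compact_opsP T : reflect (approx T) (T \in compact_ops).
Proof.
by apply: (iffP (asboolP _)) => /compact_opP.
Qed.

Fact compact_ops_closed : zmod_closed compact_ops.
Proof.
split; first by apply/compact_opsP; exact: approx0.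
move=> S T /compact_opsP aS /compact_opsP aT; apply/compact_opsP.
by apply: approxD => //; exact: approxN.
Qed.

HB.instance Definition _ := GRing.isZmodClosed.Build B compact_ops compact_ops_closed.


End compact_operators.

Local Open Scope quotient_scope.

(* The quotient of B(ell2 X) by the compact operators. *)
Definition calkin (R : realType) (X : choiceType) : Type :=
  Quotient.quot (@compact_ops R X).

Section calkin_algebra.
Variables (R : realType) (X : choiceType).
Local Notation B := (bop R X).
Local Notation Q0 := (Quotient.quot (@compact_ops R X)).
Local Notation Q := (calkin R X).
Implicit Types (S T U : B) (p q r : Q) (k : R[i]) (F : {fset X}).

HB.instance Definition _ := GRing.Zmodule.copy Q Q0.

Definition calkin_pi T : Q := \pi_Q0 T.
Definition calkin_rep q : B := repr (q : Q0).

Lemma calkin_repK q : calkin_pi (calkin_rep q) = q.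
Proof. exact: reprK. Qed.

Lemma calkin_piP S T : calkin_pi S = calkin_pi T <-> approx (S - T).
Proof.
split=> [/eqP|/compact_opsP].
  by rewrite -Quotient.idealrBE => /compact_opsP.
by rewrite Quotient.idealrBE => /eqP.
Qed.

Lemma calkin_repP T : approx (calkin_rep (calkin_pi T) - T).
Proof. by apply/calkin_piP; rewrite calkin_repK. Qed.

Lemma calkin_piD S T : calkin_pi (S + T) = calkin_pi S + calkin_pi T.
Proof. exact: (Quotient.pi_add (@compact_ops R X)). Qed.

Lemma calkin_pi0 : calkin_pi 0 = 0.
Proof. by apply: (@addrI _ (calkin_pi 0)); rewrite -calkin_piD !addr0. Qed.

Lemma calkin_piN T : calkin_pi (- T) = - calkin_pi T.
Proof. by apply: (@addrI _ (calkin_pi T)); rewrite -calkin_piD !subrr calkin_pi0. Qed.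

Lemma calkin_piB S T : calkin_pi (S - T) = calkin_pi S - calkin_pi T.
Proof. by rewrite calkin_piD calkin_piN. Qed.

Definition calkin_scale k q : Q := calkin_pi (k *: calkin_rep q).
Definition calkin_mul p q : Q := calkin_pi (bop_mul (calkin_rep p) (calkin_rep q)).
Definition calkin_adj q : Q := calkin_pi (bop_adj (calkin_rep q)).
Definition calkin_one : Q := calkin_pi (bop_one R X).

Lemma calkin_piZ k T : calkin_pi (k *: T) = calkin_scale k (calkin_pi T).
Proof.
apply/esym/calkin_piP; rewrite -scalerBr; exact/approxZ/calkin_repP.
Qed.

Lemma calkin_piM S T : calkin_pi (bop_mul S T) = calkin_mul (calkin_pi S) (calkin_pi T).
Proof.
apply/esym/calkin_piP; set S' := calkin_rep _; set T' := calkin_rep _.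
have -> : bop_mul S' T' - bop_mul S T = bop_mul (S' - S) T' + bop_mul S (T' - T).
  by apply: bopP => u; rewrite /= bopB addrA subrK.
by apply: approxD; [apply: approxMr|apply: approxMl]; exact: calkin_repP.
Qed.

Lemma calkin_piJ T : calkin_pi (bop_adj T) = calkin_adj (calkin_pi T).
Proof.
apply/esym/calkin_piP; set T' := calkin_rep _.
have -> : bop_adj T' - bop_adj T = bop_adj (T' - T).
  by rewrite -[- T]scaleN1r bop_adjD bop_adjZ rmorphN rmorph1 scaleN1r.
exact/approx_adj/calkin_repP.
Qed.

Lemma calkin_ind (P : Q -> Prop) : (forall T, P (calkin_pi T)) -> forall q, P q.
Proof. by move=> h q; rewrite -(calkin_repK q). Qed.

Fact calkin_scaleA a b q : calkin_scale a (calkin_scale b q) = calkin_scale (a * b) q.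
Proof. by elim/calkin_ind: q => T; rewrite -!calkin_piZ scalerA. Qed.
Fact calkin_scale1 : left_id 1 calkin_scale.
Proof. by elim/calkin_ind => T; rewrite -!calkin_piZ scale1r. Qed.
Fact calkin_scaleDr : right_distributive calkin_scale +%R.
Proof.
move=> k; elim/calkin_ind => S; elim/calkin_ind => T.
by rewrite -!(calkin_piZ, calkin_piD) scalerDr.
Qed.
Fact calkin_scaleDl q : {morph calkin_scale^~ q : a b / a + b}.
Proof.
move=> a b; elim/calkin_ind: q => T.
by rewrite -!calkin_piZ -calkin_piD scalerDl.
Qed.

HB.instance Definition _ := GRing.Zmodule_isLmodule.Build R[i] Q
  calkin_scaleA calkin_scale1 calkin_scaleDr calkin_scaleDl.

Definition calkin_norm q : R := inf [set opnorm T | T in [set T | calkin_pi T = q]].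

Lemma calkin_norm_has_inf q : has_inf [set opnorm T | T in [set T | calkin_pi T = q]].
Proof.
split; first by exists (opnorm (calkin_rep q)), (calkin_rep q) => //=; exact: calkin_repK.
by exists 0 => _ [T _ <-]; exact: opnorm_ge0.
Qed.

Lemma calkin_norm_ge0 q : 0 <= calkin_norm q.
Proof.
apply: lb_le_inf; first exact: (calkin_norm_has_inf q).1.
by move=> _ [T _ <-]; exact: opnorm_ge0.
Qed.

Lemma calkin_norm_le T q : calkin_pi T = q -> calkin_norm q <= opnorm T.
Proof. by move=> Tq; apply: ge_inf; [exact: (calkin_norm_has_inf q).2|exists T]. Qed.

Lemma calkin_norm_adherent q (e : R) : 0 < e ->
  exists2 T, calkin_pi T = q & opnorm T < calkin_norm q + e.
Proof.
by move=> /inf_adherent/(_ (calkin_norm_has_inf q))[_ [T Tq <-]]; exists T.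
Qed.

Lemma calkin_normD p q : calkin_norm (p + q) <= calkin_norm p + calkin_norm q.
Proof.
apply/ler_addgt0Pr => e e0; have e20 : 0 < e / 2 by rewrite divr_gt0.
have [S Sp hS] := calkin_norm_adherent p e20.
have [T Tq hT] := calkin_norm_adherent q e20.
apply: (@le_trans _ _ (opnorm (S + T))).
  by apply: calkin_norm_le; rewrite calkin_piD Sp Tq.
by rewrite (le_trans (opnormD _ _))//; lra.
Qed.

Lemma calkin_normZ_le k q : calkin_norm (k *: q) <= normc k * calkin_norm q.
Proof.
apply/ler_addgt0Pr => e e0.
have k0 : 0 < normc k + 1 by rewrite ltr_wpDl ?normc_ge0.
have [T Tq hT] := calkin_norm_adherent q (divr_gt0 e0 k0).
apply: (@le_trans _ _ (opnorm (k *: T))).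
  by apply: calkin_norm_le; rewrite calkin_piZ Tq.
rewrite opnormZ; apply: (@le_trans _ _ (normc k * (calkin_norm q + e / (normc k + 1)))).
  by rewrite ler_wpM2l ?normc_ge0// ltW.
rewrite mulrDr lerD2l mulrA ler_pdivrMr// mulrC ler_wpM2l ?(ltW e0)//.
by rewrite lerDl.
Qed.

Lemma calkin_normZ k q : calkin_norm (k *: q) = normc k * calkin_norm q.
Proof.
apply/eqP; rewrite eq_le calkin_normZ_le/=.
have [->|k0] := eqVneq k 0; first by rewrite normc0 mul0r calkin_norm_ge0.
have nk : 0 < normc k.
  rewrite lt_neqAle normc_ge0 andbT eq_sym.
  by apply: contra k0 => /eqP/eq0_normc ->.
rewrite -ler_pdivlMl// -normcV.
by have := calkin_normZ_le k^-1 (k *: q); rewrite scalerA mulVf// scale1r.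
Qed.

Lemma calkin_norm0_eq0 q : calkin_norm q = 0 -> q = 0.
Proof.
elim/calkin_ind: q => T T0; rewrite -calkin_pi0; apply/calkin_piP; rewrite subr0.
apply: approx_lim => e /(calkin_norm_adherent (calkin_pi T))[S ST].
rewrite T0 add0r => /ltW Se; exists (T - S); first exact/calkin_piP.
by rewrite opprB addrC subrK.
Qed.

Fact calkin_cnormD p q : (calkin_norm (p + q))%:C%C <=
  (calkin_norm p)%:C%C + (calkin_norm q)%:C%C :> R[i].
Proof. by rewrite -rmorphD lecR calkin_normD. Qed.
Fact calkin_cnormZ k q : (calkin_norm (k *: q))%:C%C = `|k| * (calkin_norm q)%:C%C :> R[i].
Proof. by rewrite calkin_normZ rmorphM. Qed.
Fact calkin_cnorm0 q : (calkin_norm q)%:C%C = 0 :> R[i] -> q = 0.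
Proof. by move=> [] /calkin_norm0_eq0. Qed.

HB.instance Definition _ := Lmodule_isNormed.Build R[i] Q
  calkin_cnormD calkin_cnormZ calkin_cnorm0.

Lemma calkin_normE q : `|q| = (calkin_norm q)%:C%C. Proof. by []. Qed.

Lemma calkin_complete (F : set_system Q) : ProperFilter F -> cauchy F -> cvg F.
Proof.
apply: (complete_criterion calkin_normE) => q qc.
have i2 n : 0 < (2^-1 ^+ n : R) by rewrite exprn_gt0// invr_gt0.
have lift n T : {S : B | calkin_pi S = q n.+1 &
    calkin_pi T = q n -> opnorm (T - S) <= 2 * 2^-1 ^+ n}.
  apply: cid2; have [Tq|nTq] := pselect (calkin_pi T = q n); last first.
    by exists (calkin_rep (q n.+1)); rewrite ?calkin_repK.
  have [D Dq hD] := calkin_norm_adherent (q n - q n.+1) (i2 n).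
  exists (T - D); first by rewrite calkin_piB Tq Dq opprB addrC subrK.
  move=> _; rewrite opprB addrC subrK; have := qc n n.+1 (leqnSn n); lra.
pose T := fix T n := if n is m.+1 then s2val (lift m (T m)) else calkin_rep (q 0%N).
have Tq n : calkin_pi (T n) = q n.
  by case: n => [|n] /=; [exact: calkin_repK|case: (lift n (T n))].
have Tstep n : opnorm (T n - T n.+1) <= 2 * 2^-1 ^+ n.
  by rewrite /=; case: (lift n (T n)) => S /= _; apply.
have Tc n m : (n <= m)%N -> opnorm (T n - T m) <= 4 * 2^-1 ^+ n.
  move=> /subnK <-; move: (m - n)%N => d; elim: d n => [|d IH] n.
    by rewrite add0n subrr opnorm0 mulr_ge0// ltW.
  rewrite addSnnS; have -> : T n - T (d + n.+1)%N =
      (T n - T n.+1) + (T n.+1 - T (d + n.+1)%N) by rewrite addrA subrK.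
  have := IH n.+1; have := Tstep n; have := opnormD (T n - T n.+1) (T n.+1 - T (d + n.+1)%N).
  rewrite exprS; lra.
have [|L LP] := @bop_seq_cvg _ _ (fun n => T (n + 2)%N).
  move=> n m nm; apply: le_trans (Tc _ _ _) _; first by rewrite leq_add2r.
  by rewrite exprD mulrC -mulrA [X in _ * X <= _](_ : _ = 1) ?mulr1//; field.
exists (calkin_pi L) => e /half_small[N NP]; exists (N + 2)%N => n Nn.
rewrite -Tq -calkin_piB; apply: le_trans (calkin_norm_le erefl) _.
have n2 : (2 <= n)%N := leq_trans (leq_addl N 2) Nn.
have [m nE] : exists m, n = (m + 2)%N by exists (n - 2)%N; rewrite subnK.
rewrite nE leq_add2r in Nn *.
apply: le_trans (LP m) _; apply: le_trans NP; exact: half_mono.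
Qed.

HB.instance Definition _ := Uniform_isComplete.Build Q calkin_complete.

Fact calkin_mulA : associative calkin_mul.
Proof.
elim/calkin_ind => S; elim/calkin_ind => T; elim/calkin_ind => U.
by rewrite -!calkin_piM bop_mulA.
Qed.
Fact calkin_mul1x : left_id calkin_one calkin_mul.
Proof. by elim/calkin_ind => S; rewrite -calkin_piM bop_mul1x. Qed.
Fact calkin_mulx1 : right_id calkin_one calkin_mul.
Proof. by elim/calkin_ind => S; rewrite -calkin_piM bop_mulx1. Qed.
Fact calkin_mulDl : left_distributive calkin_mul +%R.
Proof.
elim/calkin_ind => S; elim/calkin_ind => T; elim/calkin_ind => U.
by rewrite -!(calkin_piM, calkin_piD) bop_mulDl.
Qed.
Fact calkin_mulDr : right_distributive calkin_mul +%R.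
Proof.
elim/calkin_ind => S; elim/calkin_ind => T; elim/calkin_ind => U.
by rewrite -!(calkin_piM, calkin_piD) bop_mulDr.
Qed.
Fact calkin_mulZl k p q : calkin_mul (k *: p) q = k *: calkin_mul p q.
Proof.
elim/calkin_ind: p => S; elim/calkin_ind: q => T.
by rewrite -[k *: _ as X in calkin_mul X _]calkin_piZ -!calkin_piM -[RHS]calkin_piZ bop_mulZl.
Qed.
Fact calkin_mulZr k p q : calkin_mul p (k *: q) = k *: calkin_mul p q.
Proof.
elim/calkin_ind: p => S; elim/calkin_ind: q => T.
by rewrite -[k *: calkin_pi T]calkin_piZ -!calkin_piM -[RHS]calkin_piZ bop_mulZr.
Qed.
Fact calkin_adjD p q : calkin_adj (p + q) = calkin_adj p + calkin_adj q.
Proof.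
elim/calkin_ind: p => S; elim/calkin_ind: q => T.
by rewrite -calkin_piD -!calkin_piJ -calkin_piD bop_adjD.
Qed.
Fact calkin_adjZ k q : calkin_adj (k *: q) = Num.conj k *: calkin_adj q.
Proof.
elim/calkin_ind: q => T.
by rewrite -[k *: _]calkin_piZ -!calkin_piJ -[RHS]calkin_piZ bop_adjZ.
Qed.
Fact calkin_adjM p q : calkin_adj (calkin_mul p q) = calkin_mul (calkin_adj q) (calkin_adj p).
Proof.
elim/calkin_ind: p => S; elim/calkin_ind: q => T.
by rewrite -calkin_piM -!calkin_piJ -calkin_piM bop_adjM.
Qed.
Fact calkin_adjK : involutive calkin_adj.
Proof. by elim/calkin_ind => T; rewrite -!calkin_piJ bop_adjK. Qed.

Lemma calkin_normM p q : calkin_norm (calkin_mul p q) <= calkin_norm p * calkin_norm q.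
Proof.
have [p0 q0] := (calkin_norm_ge0 p, calkin_norm_ge0 q).
set a := calkin_norm p in p0 *; set b := calkin_norm q in q0 *.
apply/ler_addgt0Pr => e e0.
pose d := Num.min 1 (e / (a + b + 1)).
have pq0 : 0 < a + b + 1 by rewrite ltr_wpDl// addr_ge0.
have d0 : 0 < d by rewrite lt_min ltr01/= divr_gt0.
have d1 : d <= 1 by rewrite ge_min lexx.
have de : d * (a + b + 1) <= e by rewrite -ler_pdivlMr// ge_min lexx orbT.
have [S Sp hS] := calkin_norm_adherent p d0.
have [T Tq hT] := calkin_norm_adherent q d0.
apply: (@le_trans _ _ (opnorm (bop_mul S T))).
  by apply: calkin_norm_le; rewrite calkin_piM Sp Tq.
rewrite (le_trans (opnormM _ _))// (@le_trans _ _ ((a + d) * (b + d)))//.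
  by rewrite ler_pM ?opnorm_ge0// ltW.
have -> : (a + d) * (b + d) = a * b + d * (a + b + d) by ring.
by rewrite lerD2l (le_trans _ de)// ler_wpM2l ?(ltW d0)// lerD2l.
Qed.

Lemma calkin_norm_adj_le q : calkin_norm (calkin_adj q) <= calkin_norm q.
Proof.
apply/ler_addgt0Pr => e /(calkin_norm_adherent q)[T <- /ltW hT].
by apply: le_trans hT; rewrite -opnorm_adj; apply: calkin_norm_le; exact: calkin_piJ.
Qed.

Lemma calkin_norm_cut T F : calkin_norm (calkin_pi T) <= opnorm (T - bop_mul T (pr R F)).
Proof.
apply: calkin_norm_le; apply/calkin_piP; rewrite addrAC subrr add0r.
exact/approxN/approx_pr.
Qed.

Lemma cut_le T F : opnorm (T - bop_mul T (pr R F)) <= opnorm T.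
Proof.
apply: opnorm_le (opnorm_ge0 T) _ => u; rewrite bopBE /= -bopB.
by rewrite (le_trans (opnormP _ _))// ler_wpM2l ?opnorm_ge0// corestr_le.
Qed.

Lemma calkin_norm_cut_adherent T (e : R) : 0 < e ->
  exists F, opnorm (T - bop_mul T (pr R F)) <= calkin_norm (calkin_pi T) + e.
Proof.
move=> e0; have e20 : 0 < e / 2 by rewrite divr_gt0.
have [S ST hS] := calkin_norm_adherent (calkin_pi T) e20.
have aK : approx (bop_adj (T - S)) by apply/approx_adj/calkin_piP.
have [F FP] := approx_opnorm aK e20; exists F.
have {}FP : opnorm ((T - S) - bop_mul (T - S) (pr R F)) <= e / 2.
  rewrite -opnorm_adj; apply: le_trans FP.
  suff -> : bop_adj (T - S - bop_mul (T - S) (pr R F)) =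
    bop_adj (T - S) - bop_mul (pr R F) (bop_adj (T - S)) by [].
  have -> : - bop_mul (T - S) (pr R F) = (-1 : R[i]) *: bop_mul (T - S) (pr R F).
    by rewrite scaleN1r.
  by rewrite bop_adjD bop_adjZ bop_adjM adj_pr rmorphN rmorph1 scaleN1r.
have -> : T - bop_mul T (pr R F) =
   (S - bop_mul S (pr R F)) + ((T - S) - bop_mul (T - S) (pr R F)).
  have -> : bop_mul (T - S) (pr R F) = bop_mul T (pr R F) - bop_mul S (pr R F) by exact: bopP.
  by rewrite opprB addrACA [S + _]addrC subrK addKr.
have := opnormD (S - bop_mul S (pr R F)) ((T - S) - bop_mul (T - S) (pr R F)).
by have := cut_le S F; lra.
Qed.

Lemma calkin_norm_cstar q : calkin_norm (calkin_mul (calkin_adj q) q) = calkin_norm q ^+ 2.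
Proof.
apply/eqP; rewrite eq_le; apply/andP; split.
  rewrite (le_trans (calkin_normM _ _))// expr2 ler_wpM2r ?calkin_norm_ge0//.
  exact: calkin_norm_adj_le.
elim/calkin_ind: q => T; rewrite -calkin_piJ -calkin_piM.
apply/ler_addgt0Pr => e /(calkin_norm_cut_adherent (bop_mul (bop_adj T) T))[F].
apply: le_trans.
set P := T - bop_mul T (pr R F).
apply: (@le_trans _ _ (opnorm P ^+ 2)).
  rewrite ler_pXn2r ?nnegrE ?calkin_norm_ge0 ?opnorm_ge0//; exact: calkin_norm_cut.
rewrite -opnorm_cstar.
set W := _ - _.
have -> : bop_mul (bop_adj P) P = W - bop_mul (pr R F) W.
  have -> : bop_adj P = bop_adj T - bop_mul (pr R F) (bop_adj T).
    rewrite /P -[- bop_mul _ _]scaleN1r bop_adjD bop_adjZ bop_adjM adj_pr.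
    by rewrite rmorphN rmorph1 scaleN1r.
  have WE u : W u = bop_adj T (P u) by exact: esym (bopB (bop_adj T) (T u) (T (restr F u))).
  apply: bopP => u; transitivity (bop_adj T (P u) - restr F (bop_adj T (P u))) => //.
  by rewrite -WE.
apply: opnorm_le (opnorm_ge0 W) _ => u.
by apply: le_trans (opnormP W u); exact: (corestr_le F (W u)).
Qed.

Fact calkin_cnormM p q : `|calkin_mul p q| <= `|p| * `|q|.
Proof. by rewrite !calkin_normE -rmorphM lecR calkin_normM. Qed.
Fact calkin_cstar q : `|calkin_mul (calkin_adj q) q| = `|q| ^+ 2.
Proof. by rewrite !calkin_normE calkin_norm_cstar rmorphXn. Qed.

HB.instance Definition _ := CompleteNormedModule_isCstarAlgebra.Build R[i] Q
  calkin_mulA calkin_mul1x calkin_mulx1 calkin_mulDl calkin_mulDr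
  calkin_mulZl calkin_mulZr calkin_cnormM calkin_adjD calkin_adjZ calkin_adjM
  calkin_adjK calkin_cstar.

End calkin_algebra.

Section compression.
Variables (R : realType) (X : choiceType).
Implicit Types (H T : bop R X).

Definition matrix_of H (a a' : X) : R[i] := H (ell2_delta R a') a.

Variable Y : set X.
Implicit Types (u : ell2 R X) (v w : ell2 R Y).

(* Extension by zero from Y to X. *)
Definition ext_fun (v : Y -> R[i]) (x : X) : R[i] := oapp v 0 (insub x).

Fact ext_subproof v (F : {fset X}) : pnorm (ext_fun v) F <= l2norm v.
Proof.
pose s : seq Y := pmap insub (enum_fset F).
have us : uniq s by apply: pmap_sub_uniq; exact: fset_uniq.
pose G : {fset Y} := [fset y in s]%fset.
apply: le_trans (pnorm_le v G); rewrite ler_wsqrtr// /psum.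
have -> : \sum_(y <- G) normc (v y) ^+ 2 = \sum_(y <- s) normc (v y) ^+ 2.
  apply: perm_big; apply: uniq_perm => // y; by rewrite !inE.
rewrite /s; elim: (enum_fset F) => [|x t IH]; first by rewrite !big_nil.
rewrite big_cons /= {1}/ext_fun; case: (insub x) => [y|] /=.
  by rewrite big_cons lerD2l.
by rewrite !expr0n addr0 sqrtr0 expr0n add0r.
Qed.

Definition ext v : ell2 R X := mkell2 (ext_subproof v).

Lemma ext_val v (y : Y) : ext v (val y) = v y.
Proof. by rewrite /= /ext_fun valK. Qed.
Lemma ext_out v x : ~ Y x -> ext v x = 0.
Proof. by move=> Yx; rewrite /= /ext_fun insubF//; apply/negbTE/negP; rewrite inE. Qed.

Lemma l2norm_ext v : l2norm (ext v) <= l2norm v.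
Proof. apply: l2norm_le (l2norm_ge0 v) _; exact: ext_subproof. Qed.

Lemma extD v w : ext (v + w) = ext v + ext w.
Proof.
apply: ell2P => x; rewrite ell2DE /= /ext_fun.
by case: (insub x) => [y|] //=; rewrite addr0.
Qed.
Lemma extZ (k : R[i]) v : ext (k *: v) = k *: ext v.
Proof.
apply: ell2P => x; rewrite ell2ZE /= /ext_fun.
by case: (insub x) => [y|] //=; rewrite mulr0.
Qed.
Lemma ext0 : ext 0 = 0. Proof. by rewrite -(scale0r 0) extZ scale0r. Qed.
Lemma ext_sum I (s : seq I) (f : I -> ell2 R Y) :
  ext (\sum_(i <- s) f i) = \sum_(i <- s) ext (f i).
Proof. by elim: s => [|i s IH]; rewrite ?big_nil ?ext0// !big_cons extD IH. Qed.
Lemma ext_delta (y : Y) : ext (ell2_delta R y) = ell2_delta R (val y).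
Proof.
apply: ell2P => x; rewrite /= /ext_fun; case: insubP => [z _ <-|] /=.
  by rewrite (inj_eq val_inj).
by case: eqVneq => // ->; rewrite (valP y).
Qed.

Lemma matrix_ext_sum H v a :
  is_sum (fun y : Y => matrix_of H a (val y) * v y) (H (ext v) a).
Proof.
move=> e e0; have H0 : 0 < opnorm H + 1 by rewrite ltr_wpDl ?opnorm_ge0.
have [A AP] := restr_cvg v (divr_gt0 e0 H0); exists A => G /AP h.
have -> : \sum_(y <- G) matrix_of H a (val y) * v y = H (ext (restr G v)) a.
  rewrite restr_sum ext_sum bop_sum ell2_sumE; apply: eq_bigr => y _.
  by rewrite extZ ext_delta bopZ ell2ZE mulrC.
rewrite -ell2BE -bopB (le_trans (normc_le _ _))//.
have -> : ext v - ext (restr G v) = ext (v - restr G v).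
  by rewrite extD -(scaleN1r (restr G v)) extZ scaleN1r.
rewrite (le_trans (opnormP _ _))// (@le_trans _ _ ((opnorm H + 1) * l2norm (v - restr G v)))//.
  by rewrite ler_pM ?opnorm_ge0 ?l2norm_ge0 ?l2norm_ext// lerDl.
by rewrite -ler_pdivlMl// mulrC.
Qed.

(* [summability.sum] is the limit of the finite partial sums along the directed
   set of finite subsets; the series converges by [matrix_ext_sum]. *)
Definition compression_fun H v (b : Y) : R[i] :=
  summability.sum (fun b' : Y => matrix_of H (val b) (val b') * v b' : R[i]^o).

Lemma compression_funE H v b : compression_fun H v b = H (ext v) (val b).
Proof. exact/sumE/matrix_ext_sum. Qed.

Fact compression_subproof H v (F : {fset Y}) :
  pnorm (compression_fun H v) F <= opnorm H * l2norm v.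
Proof.
rewrite (eq_pnorm (v := fun y : Y => H (ext v) (val y))); last first.
  by move=> y _; rewrite compression_funE.
apply: (@le_trans _ _ (pnorm (H (ext v)) [fset val y | y in F]%fset)).
  rewrite ler_wsqrtr// /psum big_imfset//=; move=> x y _ _; exact: val_inj.
rewrite (le_trans (pnorm_le _ _))// (le_trans (opnormP _ _))//.
by rewrite ler_wpM2l ?opnorm_ge0// l2norm_ext.
Qed.

Definition compression_val H v : ell2 R Y := mkell2 (compression_subproof H v).

Fact compression_linear H : linear (compression_val H).
Proof.
move=> k v w; apply: ell2P => y; rewrite ell2DE ell2ZE/= !compression_funE.
by rewrite extD extZ bop_linear ell2DE ell2ZE.
Qed.

Fact compression_bounded H :
  exists M : R, forall v, l2norm (compression_val H v) <= M * l2norm v.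
Proof.
exists (opnorm H) => v; apply: l2norm_le.
  by rewrite mulr_ge0 ?opnorm_ge0 ?l2norm_ge0.
exact: compression_subproof.
Qed.

Definition compression H : bop R Y :=
  Bop (compression_linear H) (compression_bounded H).

End compression.

Section coarse_geometry.
Variables (R : realType) (X : metricType R).

Definition uniformly_discrete : Prop :=
  exists2 delta : R, 0 < delta & forall x y : X, x != y -> delta <= mdist x y.

(* [ball x r] is the open ball; as r (resp. S below) is arbitrary, closed balls
   give the same notions. *)
Definition bounded_geometry : Prop :=
  forall r : R, 0 < r -> exists N : nat, forall x : X,
    exists2 n : nat, (n < N)%N & (ball x r #= `I_n)%card.

Definition property_A : Prop :=
  forall r e : R, 0 < r -> 0 < e ->
  exists2 S : R, 0 < S & exists xi : X -> X -> R,
    [/\ forall x z, 0 <= xi x z,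
        forall x, \esum_(z in [set: X]) `|xi x z|%:E = 1%E,
        forall x z, xi x z != 0 -> ball x S z
      & forall x y, mdist x y <= r ->
          (\esum_(z in [set: X]) `|xi x z - xi y z|%:E < e%:E)%E].

Definition band_operator (H : bop R X) : Prop :=
  (exists2 r : R, 0 < r & forall a a', r < mdist a a' -> matrix_of H a a' = 0) /\
  (exists M : R, forall a a', normc (matrix_of H a a') <= M).

(* Closure for the operator norm. *)
Definition band_dominated (H : bop R X) : Prop :=
  closure [set T : bop R X | band_operator T] H.

End coarse_geometry.

Definition ess_spec (R : realType) (Sigma : cstar_spectral_set R)
    (X : choiceType) (H : bop R X) : set R[i] :=
  Sigma (calkin R X) (calkin_pi H).

(* Main.v *)
(* Extension by zero J : l2(Y0) -> l2(X0) is an isometry whose range projection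
   J J^* differs from the identity by a finite rank operator. Hence
   [T] |-> [J T J^*] is a unital, injective *-morphism between the Calkin
   algebras, and it maps the class of H_{Y0} = J^* H J to the class of H; the
   conclusion is then the invariance of a spectral set under such morphisms. *)
Require Import Defs.
From HB Require Import structures.
From mathcomp Require Import all_boot all_order all_algebra.
From mathcomp Require Import finmap all_classical all_reals.
From mathcomp Require Import ereal topology normedtype sequences esum.
From mathcomp Require Import complex.

Set Implicit Arguments.
Unset Strict Implicit.
Unset Printing Implicit Defensive.

Import Order.TTheory GRing.Theory Num.Theory.
Import numFieldNormedType.Exports.

Local Open Scope classical_set_scope.
Local Open Scope ring_scope.

Section extension_by_zero.
Variables (R : realType) (X : choiceType) (Y : set X).
Implicit Types (u : ell2 R X) (v : ell2 R Y) (S T : bop R Y).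

Definition preim_fset (F : {fset X}) : {fset Y} :=
  [fset y in pmap insub (enum_fset F)]%fset.

Lemma in_preim_fset F (y : Y) : (y \in preim_fset F) = (val y \in F).
Proof. by rewrite /preim_fset in_fset mem_pmap_sub. Qed.

(** [insub] drops the points of [F] outside [Y], and there [f] vanishes. *)
Lemma sum_preim_fset (f : X -> R[i]) F : (forall x, ~ Y x -> f x = 0) ->
  \sum_(y <- preim_fset F) f (val y) = \sum_(x <- F) f x.
Proof.
move=> f0; transitivity (\sum_(y <- pmap insub (enum_fset F)) f (val (y : Y))).
  apply: perm_big; apply: uniq_perm => //; last by move=> y; rewrite !inE.
  by apply: pmap_sub_uniq; exact: fset_uniq.
elim: (enum_fset F) => [|x s IH]; first by rewrite !big_nil.
rewrite big_cons /=; case: insubP => [y _ yx|Yx] /=; first by rewrite big_cons IH yx.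
by rewrite f0 ?add0r// => /mem_set; exact/negP.
Qed.

Lemma is_sum_val (f : X -> R[i]) l : (forall x, ~ Y x -> f x = 0) ->
  is_sum (fun y : Y => f (val y)) l -> is_sum f l.
Proof.
(* If [B] contains the image of [A], its preimage in [Y] contains [A] and gives the same partial
   sum. *)
move=> f0 fl e /fl[A AP]; exists [fset val y | y in A]%fset => B /fsubsetP AB.
rewrite -sum_preim_fset//; apply: AP; apply/fsubsetP => y yA.
by rewrite in_preim_fset AB// in_imfset.
Qed.

Fact res_subproof u (F : {fset Y}) : pnorm (fun y : Y => u (val y)) F <= l2norm u.
Proof.
apply: le_trans (pnorm_le u [fset val y | y in F]%fset).
by rewrite ler_wsqrtr// /psum big_imfset//= => x y _ _; exact: val_inj.
Qed.

Definition res u : ell2 R Y := mkell2 (res_subproof u).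

Lemma l2norm_res u : l2norm (res u) <= l2norm u.
Proof. apply: l2norm_le (l2norm_ge0 u) _; exact: res_subproof. Qed.

Lemma res_linear : linear res.
Proof. by move=> k u w; apply: ell2P. Qed.

Lemma extK : cancel (@ext R X Y) res.
Proof. by move=> v; apply: ell2P => y; exact: ext_val. Qed.

(** Both [ext] and its left inverse [res] are contractions. *)
Lemma l2norm_extE v : l2norm (ext v) = l2norm v.
Proof.
by apply/eqP; rewrite eq_le l2norm_ext /= -{1}(extK v) l2norm_res.
Qed.

(** With [ext] as J, this identifies [res] as J^*. The terms off [Y] vanish, so both sides sum the
    same series. *)
Lemma inner_ext_res v u : ell2_inner (ext v) u = ell2_inner v (res u).
Proof.
apply: is_sum_uniq (ell2_innerP _ _) _; apply: is_sum_val => [x Yx|].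
  by rewrite ext_out// rmorph0 mul0r.
by apply: eq_is_sum (ell2_innerP v (res u)) => y; rewrite ext_val.
Qed.

Lemma inner_res_ext u v : ell2_inner (res u) v = ell2_inner u (ext v).
Proof. by rewrite innerC -inner_ext_res -innerC. Qed.

(** All vectors involved vanish off [Y]. As [F] and [G] need only agree on [Y], [G] may be a
    preimage or [F] an image. *)
Lemma tail_ext v (F : {fset X}) (G : {fset Y}) :
  (forall y, (y \in G) = (val y \in F)) ->
  l2norm (ext v - restr F (ext v)) = l2norm (v - restr G v).
Proof.
move=> FG; rewrite -(l2norm_extE (v - _)); congr l2norm; apply: ell2P => x.
have [Yx|Yx] := pselect (Y x); last first.
  by rewrite ell2BE restrE !ext_out// if_same subrr.
have -> : x = val (SigSub (mem_set Yx) : Y) by [].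
by rewrite ell2BE restrE !ext_val ell2BE restrE FG.
Qed.

Fact lift_linear T : linear (fun u => ext (T (res u))).
Proof. by move=> k u w; rewrite res_linear bop_linear extD extZ. Qed.

Fact lift_bounded T :
  exists M : R, forall u, l2norm (ext (T (res u))) <= M * l2norm u.
Proof.
exists (opnorm T) => u; rewrite l2norm_extE (le_trans (opnormP _ _))//.
by rewrite ler_wpM2l ?opnorm_ge0// l2norm_res.
Qed.

Definition lift_bop T : bop R X := Bop (lift_linear T) (lift_bounded T).

Lemma lift_bopP k S T : lift_bop (k *: S + T) = k *: lift_bop S + lift_bop T.
Proof. by apply: bopP => u; rewrite bopDE bopZE /= extD extZ. Qed.

Lemma lift_bopB S T : lift_bop (S - T) = lift_bop S - lift_bop T.
Proof. by rewrite -(scaleN1r T) addrC lift_bopP scaleN1r addrC. Qed.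

(** The inner J^* J cancels by [extK]. The unit itself is sent to the projection J J^*. *)
Lemma lift_bopM S T : lift_bop (bop_mul S T) = bop_mul (lift_bop S) (lift_bop T).
Proof. by apply: bopP => u /=; rewrite extK. Qed.

Lemma lift_bopJ T : lift_bop (bop_adj T) = bop_adj (lift_bop T).
Proof.
apply: bop_adj_uniq => u w.
by rewrite /= inner_ext_res bop_adjE inner_res_ext.
Qed.

(** [approx] is compactness in terms of coordinates. One direction makes [calkin_lift] independent
    of representatives, the other makes it injective. *)
Lemma approx_lift T : approx (lift_bop T) <-> approx T.
Proof.
split=> aT e e0; have [F FP] := aT e e0.
  exists (preim_fset F) => v; rewrite -(tail_ext _ (in_preim_fset F)) -(l2norm_extE v).
  (* On [ext v] the lifted operator acts as [T] does on [v]. *)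
  by have := FP (ext v); rewrite /= extK.
exists [fset val y | y in F]%fset => u; rewrite (@tail_ext _ _ F).
  by rewrite (le_trans (FP _))// ler_wpM2l ?(ltW e0)// l2norm_res.
by move=> y; rewrite (mem_imfset _ _ val_inj).
Qed.

(** The outer factors are J J^*; they become 1 in the Calkin algebra once [Y] has finite complement,
    which leaves the class of [H]. *)
Lemma lift_compression (H : bop R X) :
  lift_bop (compression Y H) =
  bop_mul (lift_bop (bop_one R Y)) (bop_mul H (lift_bop (bop_one R Y))).
Proof.
apply: bopP => u; congr ext; apply: ell2P => y.
by rewrite /= compression_funE.
Qed.

Definition calkin_lift (q : calkin R Y) : calkin R X :=
  calkin_pi (lift_bop (calkin_rep q)).

(** Two representatives differ by a compact operator, whose lift is again compact. *)
Lemma calkin_lift_pi T : calkin_lift (calkin_pi T) = calkin_pi (lift_bop T).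
Proof.
by apply/calkin_piP; rewrite -lift_bopB; apply/approx_lift/calkin_repP.
Qed.

Lemma calkin_lift_inj : injective calkin_lift.
Proof.
elim/calkin_ind => S; elim/calkin_ind => T; rewrite !calkin_lift_pi.
by move=> /calkin_piP; rewrite -lift_bopB => /approx_lift/calkin_piP.
Qed.

(** J J^* erases the coordinates off [Y], so its complement keeps exactly those. *)
Lemma lift_bop1 : finite_set (~` Y) ->
  bop_one R X - lift_bop (bop_one R Y) = pr R (fset_set (~` Y)).
Proof.
move=> finYC; apply: bopP => u; apply: ell2P => x; rewrite bopBE ell2BE [RHS]restrE.
rewrite in_fset_set//; have [Yx|Yx] := pselect (Y x).
  rewrite memNset//.
  have -> : x = val (SigSub (mem_set Yx) : Y) by [].
  by rewrite [lift_bop _ _ _]ext_val subrr.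
by rewrite mem_set// [lift_bop _ _ _]ext_out// subr0.
Qed.

Lemma calkin_pi_lift1 : finite_set (~` Y) ->
  calkin_pi (lift_bop (bop_one R Y)) = cone.
Proof.
(* A factor 1 is inserted to match [approx_pr], which is about products ending in a finite
   coordinate projection. *)
move=> finYC; apply/esym/calkin_piP; rewrite lift_bop1// -[pr _ _]bop_mul1x; exact: approx_pr.
Qed.

Lemma calkin_lift_morphism : finite_set (~` Y) ->
  unital_star_morphism calkin_lift.
Proof.
move=> finYC; split.
- move=> k; elim/calkin_ind => S; elim/calkin_ind => T.
  rewrite -[k *: calkin_pi S]calkin_piZ -calkin_piD !calkin_lift_pi.
  by rewrite lift_bopP calkin_piD calkin_piZ.
- elim/calkin_ind => S; elim/calkin_ind => T.
  by rewrite -[cmul _ _]calkin_piM !calkin_lift_pi lift_bopM calkin_piM.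
- by rewrite [LHS]calkin_lift_pi calkin_pi_lift1.
- elim/calkin_ind => T.
  by rewrite -[adj _]calkin_piJ !calkin_lift_pi lift_bopJ calkin_piJ.
Qed.

Lemma calkin_lift_compression (H : bop R X) : finite_set (~` Y) ->
  calkin_lift (calkin_pi (compression Y H)) = calkin_pi H.
Proof.
move=> finYC; rewrite calkin_lift_pi lift_compression !calkin_piM calkin_pi_lift1//.
by rewrite calkin_mul1x calkin_mulx1.
Qed.

End extension_by_zero.

Theorem theorem9p2 (R : realType) (X0 : metricType R) (H : bop R X0)
    (Y0 : set X0) (Sigma : cstar_spectral_set R) :
  infinite_set [set: X0] ->
  uniformly_discrete X0 ->
  bounded_geometry X0 ->
  property_A X0 ->
  band_dominated H ->
  finite_set (~` Y0) ->
  ess_spec Sigma H = ess_spec Sigma (compression Y0 H).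
Proof.
(* The class of [H] is rewritten as the image of the class of the compression, so that [spec_inj]
   applies. *)
move=> _ _ _ _ _ finYC; rewrite /ess_spec -(calkin_lift_compression H finYC).
exact: spec_inj (@calkin_lift_morphism R X0 Y0 finYC) (@calkin_lift_inj R X0 Y0) _.
Qed.
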